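(* There are positive constants $C_1,C_2$ such that for every $\lambda>0$ and for all sufficiently large $N$, the number $\mathcal R_N$ of escaping rays in the final random quadrangulation $G_{\mathcal V_N}(N)$ satisfies $$C_1\sqrt{\lambda}\,N\le \mathbb{E}(\mathcal R_N)< C_2\sqrt{\lambda}\,N .$$
   Context: Let $\mathcal V$ be the set of points of a homogeneous Poisson process on $\mathbb{R}^2$ with intensity $\lambda>0$, let $\Lambda_N=[0,N]^2$ and $\mathcal V_N=\mathcal V\cap\Lambda_N$. Each $u\in\mathcal V_N$ is assigned, independently of everything else, a direction $d_u\in\{(0,1),(1,0)\}$, each with probability $1/2$. At time $0$, from every $u\in\mathcal V_N$ two rays $\mathcal L^{+}_{u,d_u}$ and $\mathcal L^{-}_{u,d_u}$ start growing in $\mathbb{R}^2$, in directions $+d_u$ and $-d_u$ respectively, with constant speed $1$; a ray grows until its tip reaches another ray (i.e. touches a point of a ray of another initial point as grown up to that time), at which moment it stops and remains unchanged thereafter. Only points of $\mathcal V_N$ emit rays. $\mathcal L^{\pm}_{u,d_u}(t)$ denotes the (closed) segment occupied by the ray at time $t$, and $G_{\mathcal V_N}(t)$ is the collection of all rays $\mathcal L^{\pm}_{u,d_u}(t)$, $u\in\mathcal V_N$. (Inside $\Lambda_N$ the configuration does not change after time $N$.) A ray $\mathcal L^{\pm}_{u,d_u}(N)$ in $G_{\mathcal V_N}(N)$ is called an escaping ray if it reaches the border of $\Lambda_N$, i.e. $\mathcal L^{\pm}_{u,d_u}(N)\cap\partial\Lambda_N\neq\emptyset$. The two rays from the same point are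 counted separately. ''Sufficiently large $N$'' may depend on $\lambda$; $C_1,C_2$ do not. *)

(* Defs.v *)
From HB Require Import structures.
From mathcomp Require Import all_boot all_order all_algebra.
From mathcomp Require Import all_classical all_reals all_analysis.
From mathcomp Require Import measurable_realfun lra.
Set Implicit Arguments.
Unset Strict Implicit.
Unset Printing Implicit Defensive.
Import Order.TTheory GRing.Theory Num.Theory.
Import numFieldNormedType.Exports.
Local Open Scope classical_set_scope.
Local Open Scope ring_scope.

Section Growth.
Context {R : realType}.

(* The mark of a point is its direction: true is horizontal, false is
   vertical. *)
Local Notation marked_point := ((R * R) * bool)%type.

(* (u, d, s) is the ray L^+_{u,d} if s = false and L^-_{u,d} if s = true. *)
Local Notation ray := (marked_point * bool)%type.

Definition base (r : ray) : R * R := r.1.1.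

Definition dirv (d : bool) : R * R := if d then (1, 0) else (0, 1).

Definition tip (r : ray) (t : R) : R * R :=
  ((base r).1 + (-1) ^+ r.2 * t * (dirv r.1.2).1,
   (base r).2 + (-1) ^+ r.2 * t * (dirv r.1.2).2).

Implicit Types (c : set marked_point) (tau : ray -> \bar R) (r : ray).

Definition rays_of c : set ray := [set r | c r.1].

(* The segment occupied at time t by the ray r, when every ray r' grows
   with unit speed until time tau r'. *)
Definition grown tau r (t : R) : set (R * R) :=
  [set tip r s | s in [set s : R | 0 <= s <= t /\ (s%:E <= tau r)%E]].

Definition hit_times c tau r : set R :=
  [set t : R | 0 <= t /\ exists r' : ray,
    [/\ rays_of c r', base r' <> base r & grown tau r' t (tip r t)]].

(* tau gives the stopping times of the rays emitted by c: each ray stops at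
   the first time at which its tip touches a ray of another point, as grown up
   to that time (and never stops if tau r = +oo). *)
Definition stopping_times c tau : Prop :=
  forall r, rays_of c r ->
    tau r = ereal_inf [set t%:E | t in hit_times c tau r].

(* For finite c the system defining stopping_times has exactly one solution on
   the rays of c, see stopping_times_unique and stop_timeP below. *)
Definition stop_time c : ray -> \bar R :=
  xget (fun=> 0%E) [set tau | stopping_times c tau].

Definition square (N : R) : set (R * R) := `[0, N] `*` `[0, N].

Definition border (A : set (R * R)) : set (R * R) := closure A `\` A°.

Definition escaping_rays (N : R) c : set ray :=
  [set r | rays_of c r /\
           grown (stop_time c) r N `&` border (square N) !=set0].

Lemma finite_argmin (U : choiceType) disp (O : orderType disp) (F : set U)
    (f : U -> O) :
  finite_set F -> F !=set0 -> exists2 i, F i & forall j, F j -> (f i <= f j)%O.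
Proof.
move=> /finite_seqP[s ->] {F}; elim: s => [[x]//|x s IHs _].
have [[i si imin]|s0] := pselect (exists2 i, [set` s] i &
    forall j, [set` s] j -> (f i <= f j)%O); last first.
  exists x => [|j /=]; first by rewrite /= mem_head.
  rewrite inE => /predU1P[->//|js]; exfalso; apply: s0.
  by apply: IHs; exists j.
have [xi|ix] := leP (f x) (f i).
  exists x => [|j /=]; first by rewrite /= mem_head.
  by rewrite inE => /predU1P[->//|/imin]; exact: le_trans.
exists i => [|j /=]; first by rewrite /= inE si orbT.
by rewrite inE => /predU1P[->|/imin//]; exact: ltW.
Qed.

Lemma pair_hit_min (r r' : ray) (z : \bar R) (t0 s0 : R) :
  0 <= s0 <= t0 -> (s0%:E <= z)%E -> tip r' s0 = tip r t0 ->
  exists t s : R, [/\ 0 <= s <= t, (s%:E <= z)%E, tip r' s = tip r t &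
    forall t1 s1 : R, 0 <= s1 <= t1 -> (s1%:E <= z)%E ->
      tip r' s1 = tip r t1 -> t <= t1].
Proof.
case: r => [[[x y] d] b]; case: r' => [[[x' y'] d'] b'].
rewrite /tip /base /dirv /= => st0 s0z.
have Ho k : s0 + t0 = k ->
  exists t s : R, [/\ 0 <= s <= t, (s%:E <= z)%E, s + t = k &
    forall t1 s1 : R, 0 <= s1 <= t1 -> (s1%:E <= z)%E ->
      s1 + t1 = k -> t <= t1].
  case: z s0z => [z| |]; rewrite ?leey//.
    rewrite lee_fin => s0z kE.
    have [h|h] := leP (k / 2) (k - z).
      exists (k - z), z; split; rewrite ?lee_fin; try lra.
      by move=> t1 s1; rewrite lee_fin; lra.
    exists (k / 2), (k / 2); split; rewrite ?lee_fin; try lra.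
    by move=> t1 s1; rewrite lee_fin; lra.
  move=> _ kE; exists (k / 2), (k / 2); rewrite leey; split=> //; try lra.
  by move=> t1 s1 h _ e; lra.
have Hp k : t0 - s0 = k ->
  exists t s : R, [/\ 0 <= s <= t, (s%:E <= z)%E, t - s = k &
    forall t1 s1 : R, 0 <= s1 <= t1 -> (s1%:E <= z)%E ->
      t1 - s1 = k -> t <= t1].
  move=> kE; exists k, 0; split; [lra| |lra|move=> *; lra].
  by apply: le_trans s0z; rewrite lee_fin; lra.
have [tO [sO [q1 q2 q3 q4]]] := Ho _ erefl.
have [tp [sp [p1 p2 p3 p4]]] := Hp _ erefl.
case: d; case: d'; case: b; case: b' => /=; rewrite ?expr1 ?expr0 => -[e1 e2].
all: first
  [ by exists t0, s0; split=> //; [congr pair; lra|move=> t1 s1 _ _ [? ?]; lra]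
  | by exists tp, sp; split=> //; [congr pair; lra|
      move=> t1 s1 hh hz [? ?]; apply: (p4 t1 s1) => //; lra]
  | by exists tO, sO; split=> //; [congr pair; lra|
      move=> t1 s1 hh hz [? ?]; apply: (q4 t1 s1) => //; lra]].
Qed.

Lemma finite_rays_of c : finite_set c -> finite_set (rays_of c).
Proof.
move=> fc; apply: (@sub_finite_set _ _ (c `*` [set: bool])).
  by move=> r.
exact: finite_setX.
Qed.

Lemma hit_times_min c tau r : finite_set c -> hit_times c tau r !=set0 ->
  exists2 t, hit_times c tau r t & forall t1, hit_times c tau r t1 -> t <= t1.
Proof.
move=> fc [t0 ht0].
pose S (r' : ray) : set R := [set t | exists s,
  [/\ 0 <= s <= t, (s%:E <= tau r')%E & tip r' s = tip r t]].
have Smin r' : S r' !=set0 -> exists2 t, S r' t & forall t1, S r' t1 -> t <= t1.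
  move=> [u [s [us su e]]]; have [t [s1 [h1 h2 h3 h4]]] := pair_hit_min us su e.
  by exists t; [exists s1|move=> t1 [s2 [? ? ?]]; apply: h4; eassumption].
pose F : set ray :=
  [set r' | [/\ rays_of c r', base r' <> base r & S r' !=set0]].
have hitE t : hit_times c tau r t <-> exists2 r', F r' & S r' t.
  split=> [[t_ge0 [r' [cr' br [s [st sz] e]]]]|[r' [cr' br _] [s [st sz e]]]].
    by exists r' => //; [split=> //; exists t|]; exists s.
  split; first by case/andP: st; exact: le_trans.
  by exists r'; split=> //; exists s.
have [f fP] : {f : ray -> R & forall r', F r' ->
    S r' (f r') /\ forall t1, S r' t1 -> f r' <= t1}.
  apply: (@choice _ _ (fun r' u => F r' -> S r' u /\ forall t1, S r' t1 -> u <= t1)) => r'.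
  have [[_ _ /Smin[t ? ?]]|nF] := pselect (F r'); first by exists t.
  by exists 0.
have fF : finite_set F.
  by apply: sub_finite_set (finite_rays_of fc) => r' [].
have [|r1 Fr1 r1min] := finite_argmin f fF.
  by have /hitE[r' Fr' _] := ht0; exists r'.
exists (f r1); first by apply/hitE; exists r1 => //; case: (fP _ Fr1).
move=> t1 /hitE[r' Fr' Srt]; apply: le_trans (r1min _ Fr') _.
by case: (fP _ Fr') => _; apply.
Qed.

Definition first_hit c tau r : \bar R :=
  ereal_inf [set t%:E | t in hit_times c tau r].

Lemma first_hit_le c tau r t : hit_times c tau r t -> (first_hit c tau r <= t%:E)%E.
Proof. by move=> h; apply: ereal_inf_lbound; exists t. Qed.

Lemma first_hit_min c tau r : finite_set c -> (first_hit c tau r < +oo)%E ->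
  exists2 t, hit_times c tau r t & first_hit c tau r = t%:E.
Proof.
move=> fc; have [/hit_times_min[]//|] := pselect (hit_times c tau r !=set0).
  move=> t ht tmin _; exists t => //; apply/eqP; rewrite eq_le first_hit_le//=.
  by apply: le_ereal_inf_tmp => _ [u hu <-]; rewrite lee_fin tmin.
move=> /set0P/negP/negPn/eqP h0.
by rewrite /first_hit h0 image_set0 ereal_inf0 ltxx.
Qed.

Lemma stopping_times_unique c tau1 tau2 : finite_set c ->
  stopping_times c tau1 -> stopping_times c tau2 ->
  forall r, rays_of c r -> tau1 r = tau2 r.
Proof.
move=> fc h1 h2.
pose B := [set r | rays_of c r /\ tau1 r <> tau2 r].
have [[r0 Br0]|nB] := pselect (B !=set0); last first.
  by move=> r cr; apply: contrapT => ne; apply: nB; exists r.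
have fB : finite_set B by apply: sub_finite_set (finite_rays_of fc) => r [].
have [|r [cr rne] rmin] :=
  finite_argmin (fun r => Order.min (tau1 r) (tau2 r)) fB; first by exists r0.
exfalso; clear r0 Br0 fB.
wlog lt12 : tau1 tau2 h1 h2 @B rne rmin / (tau1 r < tau2 r)%E.
  move=> W; have [| |//] := ltgtP (tau1 r) (tau2 r); first exact: W.
  apply: W => //; first exact/nesym.
  move=> j [cj /nesym ne]; rewrite minC [leRHS]minC.
  exact: rmin.
have t1fin : (first_hit c tau1 r < +oo)%E.
  by rewrite -[first_hit _ _ _]h1//; apply: lt_le_trans lt12 (leey _).
have [t ht tE] := first_hit_min fc t1fin.
case: (ht) => t0 [r' [cr' br [s [st sz] e]]].
have tau1E : tau1 r = t%:E by rewrite h1.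
have [sz2|sz2] := leP (s%:E)%E (tau2 r').
  have : (tau2 r <= t%:E)%E.
    rewrite h2//; apply: first_hit_le; split=> //; exists r'; split=> //.
    by exists s.
  by rewrite -tau1E leNgt lt12.
have : B r'.
  split=> // ee; move: sz; rewrite ee leNgt sz2 //.
move=> /rmin; rewrite leNgt => /negP; apply.
rewrite (min_l (ltW lt12)) gt_min; apply/orP; right.
rewrite (lt_le_trans sz2)// tau1E lee_fin.
by case/andP: st.
Qed.

Lemma count_ltn (U : eqType) (p q : pred U) (s : seq U) x :
  (forall y, p y -> q y) -> x \in s -> q x -> ~~ p x ->
  (count p s < count q s)%N.
Proof.
move=> pq xs qx px; elim: s xs => // y s IHs; rewrite inE => /predU1P[<-|xs]/=.
  by rewrite (negbTE px) qx add0n add1n ltnS sub_count.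
have := IHs xs; have : (p y <= q y)%N by case py: (p y) => //; rewrite pq.
by move=> h1 h2; rewrite -addnS leq_add.
Qed.

Lemma stopping_times_exists c : finite_set c ->
  exists tau, stopping_times c tau.
Proof.
move=> fc; have frc := finite_rays_of fc; have /finite_seqP[s sE] := frc.
pose inv tau (a : R) := forall r, rays_of c r ->
  (tau r = first_hit c tau r /\ (tau r <= a%:E)%E) \/
  (tau r = +oo%E /\ (a%:E <= first_hit c tau r)%E).
suff step n : forall tau a, inv tau a ->
    (count (fun r => tau r == +oo%E) s < n)%N ->
    exists tau, stopping_times c tau.
  apply: (step (size s).+1 (fun=> +oo%E) 0); last by rewrite ltnS count_size.
  move=> r cr; right; split=> //.
  by apply: le_ereal_inf_tmp => _ [u [u0 _] <-]; rewrite lee_fin.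
elim: n => [//|n IHn] tau a ia; rewrite ltnS => cnt.
pose Al := [set r | [/\ rays_of c r, tau r = +oo%E & (first_hit c tau r < +oo)%E]].
have [[r0 Al0]|nAl] := pselect (Al !=set0); last first.
  exists tau => r cr; case: (ia _ cr) => [[]//|[too _]].
  rewrite too; apply/esym/eqP; rewrite -leye_eq leNgt; apply/negP => h.
  by apply: nAl; exists r.
have fAl : finite_set Al by apply: sub_finite_set frc => r [].
have [|r1 Al1 r1min] := finite_argmin (first_hit c tau) fAl; first by exists r0.
case: (Al1) => cr1 too1 /(first_hit_min fc)[a' ha' aE].
have aa' : a <= a'.
  case: (ia _ cr1) => -[]; rewrite too1; first by move=> _; rewrite leye_eq.
  by rewrite aE lee_fin.
pose tau' r := if `[< Al r /\ first_hit c tau r = a'%:E >] then a'%:E else tau r.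
have tau'le r : (tau' r <= tau r)%E.
  by rewrite /tau'; case: asboolP => // -[[_ -> _] _]; rewrite leey.
have hitS r t : hit_times c tau' r t -> hit_times c tau r t.
  move=> [t0 [r' [cr' br [u [ut uz] e]]]]; split=> //; exists r'; split=> //.
  by exists u => //; split=> //; apply: le_trans (tau'le _).
have hitE r t : t <= a' -> hit_times c tau r t -> hit_times c tau' r t.
  move=> ta [t0 [r' [cr' br [u [ut uz] e]]]]; split=> //; exists r'; split=> //.
  exists u => //; split=> //; rewrite /tau'; case: asboolP => // _.
  by rewrite lee_fin (le_trans _ ta)//; case/andP: ut.
have fhS r : (first_hit c tau r <= first_hit c tau' r)%E.
  by apply: le_ereal_inf_tmp => _ [u hu <-]; apply: first_hit_le; exact: hitS.
have fhE r : (first_hit c tau r <= a'%:E)%E ->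
    first_hit c tau' r = first_hit c tau r.
  move=> h; apply/eqP; rewrite eq_le fhS andbT.
  have [|t ht tE] := @first_hit_min c tau r fc.
    by apply: le_lt_trans h _; rewrite ltry.
  rewrite tE; apply: first_hit_le; apply: hitE => //.
  by rewrite -lee_fin -tE.
apply: (IHn tau' a').
  move=> r cr; have [A|nA] := pselect (Al r /\ first_hit c tau r = a'%:E).
    have tE : tau' r = a'%:E by rewrite /tau' asboolT.
    by case: A => _ e; left; rewrite tE fhE e.
  have tE : tau' r = tau r by rewrite /tau' asboolF.
  rewrite tE.
  case: (ia _ cr) => -[e le_a].
    left; have le_a' : (tau r <= a'%:E)%E.
      by apply: le_trans le_a _; rewrite lee_fin.
    by rewrite fhE -?e.
  right; split=> //; apply: le_trans (fhS r).
  have [h|h] := ltP (first_hit c tau r) +oo%E.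
    by rewrite -aE; apply: r1min.
  by apply: le_trans h; rewrite leey.
apply: leq_trans cnt; apply: (@count_ltn _ _ _ _ r1).
- by move=> r /eqP h; rewrite -leye_eq -h.
- by have : rays_of c r1 by []; rewrite sE.
- by rewrite too1.
- by rewrite /tau'; case: asboolP => // nA; exfalso; apply: nA.
Qed.

Lemma stop_timeP c : finite_set c -> stopping_times c (stop_time c).
Proof.
move=> /stopping_times_exists[tau h].
by rewrite /stop_time; case: xgetP => [_ ->|/(_ tau)].
Qed.

End Growth.

Section PoissonProcess.
Context {R : realType} d (T : measurableType d) (P : probability T R).
Local Open Scope ereal_scope.

Definition area : set (R * R) -> \bar R :=
  (@lebesgue_measure R \x @lebesgue_measure R).

Record poisson_process (lambda : R) (V : T -> set (R * R)) : Prop := {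
  poisson_process_measurable : forall A : set (R * R), measurable A ->
    measurable_fun setT ((fun w => counting (V w `&` A)) : T -> \bar R);
  poisson_process_law : forall (A : set (R * R)) (n : nat),
    measurable A -> area A < +oo ->
    let m := (lambda * fine (area A))%R in
    P [set w | counting (V w `&` A) = n%:R%:E :> \bar R]
      = (expR (- m) * m ^+ n / n`!%:R)%:E;
  poisson_process_indep : forall (k : nat) (A : 'I_k -> set (R * R))
      (n : 'I_k -> nat),
    (forall i, measurable (A i)) -> (forall i, area (A i) < +oo) ->
    trivIset setT A ->
    P (\bigcap_(i in [set: 'I_k])
         [set w | counting (V w `&` A i) = (n i)%:R%:E :> \bar R])
      = \prod_(i < k)
          P [set w | counting (V w `&` A i) = (n i)%:R%:E :> \bar R]
}.

Definition sigma_of (X : nat -> T -> R * R) : set (set T) :=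
  <<s [set E | exists (k : nat) (B : set (R * R)),
                 measurable B /\ E = X k @^-1` B] >>.

(* X enumerates the points of a Poisson process without repetition, and D k is
   the direction of the point X k.  The last field says that the D k are fair,
   mutually independent, and independent of the sequence X. *)
Record marked_poisson_process (lambda : R) (X : nat -> T -> R * R)
    (D : nat -> T -> bool) : Prop := {
  mpp_measurable_point : forall k, measurable_fun setT (X k);
  mpp_injective : {ae P, forall w, injective (X ^~ w)};
  mpp_poisson : poisson_process lambda (fun w => range (X ^~ w));
  mpp_measurable_mark : forall k, measurable_fun setT (D k);
  mpp_marks : forall (E : set T) (m : nat) (b : 'I_m -> bool),
    sigma_of X E ->
    P (E `&` \bigcap_(i in [set: 'I_m]) [set w | D i w = b i])
      = P E * ((2^-1) ^+ m)%R%:E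
}.

Definition marked_points_in (A : set (R * R)) (X : nat -> T -> R * R)
    (D : nat -> T -> bool) (w : T) : set ((R * R) * bool) :=
  [set (X k w, D k w) | k in [set k | A (X k w)]].

(* The rays are those of the points in [0, N]^2 only. *)
Definition nb_escaping_rays (N : R) (X : nat -> T -> R * R)
    (D : nat -> T -> bool) (w : T) : \bar R :=
  counting (escaping_rays N (marked_points_in (square N) X D w)).

End PoissonProcess.

(* Main.v *)
Require Import Defs.
From HB Require Import structures.
From mathcomp Require Import all_boot all_order all_algebra.
From mathcomp Require Import all_classical all_reals all_analysis.
From mathcomp Require Import measurable_realfun.
From mathcomp Require Import finmap zify lra ring.
Import Order.TTheory GRing.Theory Num.Theory.
Import numFieldNormedType.Exports.
Local Open Scope classical_set_scope.
Local Open Scope ring_scope.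
Set Implicit Arguments.
Unset Strict Implicit.

(** Cut the square into cells of side [e] of order [1 / sqrt lambda]. A gadget
    is a cell that contains exactly one point of the process, while the eight
    cells around it contain none. Since rays have unit speed, no other ray can
    reach the rays of that point before they leave their cell.

    Lower bound: a gadget with horizontal mark along the right side produces an
    escaping ray, and each of the [N / e] cells along that side is the center of
    one with probability at least [rho], a constant that depends on nothing.

    Upper bound: a gadget whose mark is orthogonal to a ray, and which lies in
    its row or column between its origin and the border, stops that ray. The
    disjoint [3 x 3] blocks ahead of a ray are independent gadgets, so the
    expected number of rays of a cell at distance [k e] from the border that
    escape is at most [expR 4 * (1 - rho) ^+ (k %/ 3)]. Summing over the cells
    gives a multiple of [N / e]. *)

(** * Counting and sigma-algebras *)

Lemma setIforall_cons {I : eqType} {T : Type} (G : I -> set T) (i : I) (s : seq I) :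
  [set w | forall j, j \in i :: s -> G j w] =
  G i `&` [set w | forall j, j \in s -> G j w].
Proof.
apply/seteqP; split=> w /=.
  by move=> h; split=> [|j js]; apply: h; rewrite inE ?eqxx ?js ?orbT.
by move=> [gi h] j; rewrite inE => /predU1P[->|/h].
Qed.

Lemma setIforall_nil {I : eqType} {T : Type} (G : I -> set T) :
  [set w | forall j, j \in [::] -> G j w] = setT.
Proof. by apply/seteqP; split. Qed.

Lemma measurable_forall_in {d} {T : measurableType d} {I : eqType}
    (G : I -> set T) (s : seq I) :
  (forall i, i \in s -> measurable (G i)) ->
  measurable [set w | forall j, j \in s -> G j w].
Proof.
elim: s => [|i s IHs] mG; first by rewrite setIforall_nil.
rewrite setIforall_cons; apply: measurableI; first by apply: mG; rewrite mem_head.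
by apply: IHs => j js; apply: mG; rewrite inE js orbT.
Qed.

Section Counting.
Context {R : realType}.

Lemma counting_seq {U : choiceType} (s : seq U) :
  uniq s -> counting [set` s] = (size s)%:R%:E :> \bar R.
Proof.
move=> us; have fs : finite_set [set` s] by apply/finite_seqP; exists s.
rewrite /counting asboolT//; congr (_%:R%:E).
apply/perm_size/uniq_perm => // x.
by apply/idP/idP; rewrite in_fset_set// mem_setE.
Qed.

Lemma finite_set_uniq_seq {U : choiceType} (A : set U) : finite_set A ->
  exists2 s, uniq s & A = [set` s].
Proof.
move=> /finite_seqP[s ->]; exists (undup s); first exact: undup_uniq.
by apply/seteqP; split=> x /=; rewrite mem_undup.
Qed.

Lemma counting_infinite {U : choiceType} (A : set U) :
  ~ finite_set A -> counting A = +oo%E :> \bar R.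
Proof. by move=> fA; rewrite /counting asboolF. Qed.

Lemma counting_ge0 {U : choiceType} (A : set U) : (0 <= counting A :> \bar R)%E.
Proof. by rewrite /counting; case: ifPn; rewrite ?lee_fin. Qed.

Lemma finite_countingP {U : choiceType} (A : set U) : finite_set A ->
  exists n, counting A = n%:R%:E :> \bar R.
Proof.
by move=> /finite_set_uniq_seq[s us ->]; exists (size s); rewrite counting_seq.
Qed.

Lemma counting_le {U : choiceType} (A B : set U) : A `<=` B ->
  (counting A <= counting B :> \bar R)%E.
Proof.
move=> AB; have [fB|fB] := pselect (finite_set B); last first.
  by rewrite (counting_infinite fB) leey.
have [s us AE] := finite_set_uniq_seq (sub_finite_set AB fB).
have [t ut BE] := finite_set_uniq_seq fB.
rewrite AE BE !counting_seq// lee_fin ler_nat uniq_leq_size// => x xs.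
have : B x by apply: AB; rewrite AE.
by rewrite BE.
Qed.

Lemma size_le_counting {U : choiceType} (s : seq U) (A : set U) (n : nat) :
  uniq s -> [set` s] `<=` A -> counting A = n%:R%:E :> \bar R -> (size s <= n)%N.
Proof.
by move=> us /counting_le + cA; rewrite counting_seq// cA lee_fin ler_nat.
Qed.

Lemma counting_image {U V : choiceType} (f : U -> V) (A : set U) :
  {in A &, injective f} -> counting (f @` A) = counting A :> \bar R.
Proof.
move=> fi; have [fA|fA] := pselect (finite_set A).
  have [s us AE] := finite_set_uniq_seq fA.
  have -> : f @` A = [set` map f s].
    by apply/seteqP; rewrite AE; split=> [_ [x xs <-]|y /mapP[x xs ->]] /=;
      [exact: map_f|exists x].
  rewrite AE !counting_seq ?size_map// map_inj_in_uniq// => x y xs ys.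
  by apply: fi; apply: mem_set; rewrite AE.
rewrite !counting_infinite// => h; apply: fA.
by rewrite -(eq_finite_set (inj_card_eq fi)).
Qed.

Lemma counting_setU_le {U : choiceType} (A B : set U) :
  (counting (A `|` B) <= counting A + counting B :> \bar R)%E.
Proof.
have [fA|fA] := pselect (finite_set A); last first.
  rewrite (counting_infinite fA) addye ?leey//.
  by rewrite gt_eqF// (lt_le_trans _ (counting_ge0 _)).
have [fB|fB] := pselect (finite_set B); last first.
  rewrite (counting_infinite fB) addey ?leey//.
  by rewrite gt_eqF// (lt_le_trans _ (counting_ge0 _)).
have [s us ->] := finite_set_uniq_seq fA.
have [t ut ->] := finite_set_uniq_seq fB.
have -> : [set` s] `|` [set` t] = [set` undup (s ++ t)].
  by apply/seteqP; split=> x /=; rewrite mem_undup mem_cat; [move=> /orP|move=> /orP].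
rewrite !counting_seq ?undup_uniq// -EFinD lee_fin -natrD ler_nat.
by rewrite -size_cat size_undup.
Qed.

Lemma counting_bigcup_seq_le {U : choiceType} {I : eqType} (s : seq I)
    (F : I -> set U) :
  (counting [set x | exists2 i, i \in s & F i x]
     <= \sum_(i <- s) counting (F i) :> \bar R)%E.
Proof.
elim: s => [|i s IHs].
  have -> : [set x | exists2 i, i \in [::] & F i x] = [set` [::]].
    by apply/seteqP; split=> x //= -[].
  by rewrite big_nil counting_seq.
rewrite big_cons; apply: (le_trans _ (leeD2l _ IHs)).
apply: (le_trans _ (counting_setU_le _ _)).
apply: counting_le => x [j]; rewrite inE => /predU1P[->|js] Fx; [left|right] => //.
by exists j.
Qed.

(** This turns the cardinality of a set of indices into a countable combination of finite counts,
    each of which is easily seen to be measurable. *)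
Lemma counting_natP (A : set nat) (n : nat) : counting A = n%:R%:E :> \bar R <->
  exists M, forall m, (M <= m)%N -> count (fun k => `[< A k >]) (iota 0 m) = n.
Proof.
have AE M : (forall k, A k -> (k < M)%N) ->
    counting A = (count (fun k => `[< A k >]) (iota 0 M))%:R%:E :> \bar R.
  move=> AM; rewrite -size_filter -counting_seq ?filter_uniq ?iota_uniq//.
  congr counting; apply/seteqP; split=> k /=.
    by move=> Ak; rewrite mem_filter mem_iota /= add0n AM// andbT; apply/asboolP.
  by rewrite mem_filter => /andP[/asboolP].
split=> [cA|[M cM]].
  have [fA|/counting_infinite cA'] := pselect (finite_set A); last first.
    by move: cA; rewrite cA'.
  have [s us AE'] := finite_set_uniq_seq fA.
  exists (\max_(k <- s) k.+1)%N => m sm.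
  have /AE : forall k, A k -> (k < m)%N.
    move=> k; rewrite AE' /= => ks; apply: leq_trans sm.
    by rewrite (big_rem _ ks) /= leq_max leqnn.
  by rewrite cA => -[/eqP]; rewrite eqr_nat => /eqP.
rewrite (AE M) ?cM// => k Ak; rewrite ltnNge; apply/negP => Mk.
have := cM k.+1 (leqW Mk).
rewrite -addn1 iotaD count_cat /= cM// add0n asboolT//; lia.
Qed.

End Counting.

Section SigmaAlgebra.
Context {T : Type} (S : set (set T)) (sS : sigma_algebra setT S).

Lemma sigmaC A : S A -> S (~` A).
Proof. by move=> SA; rewrite -setTD; case: sS => _ h _; exact: h. Qed.

Lemma sigma_bigcup (F : nat -> set T) : (forall k, S (F k)) ->
  S [set w | exists k, F k w].
Proof.
case: sS => _ _ h SF; have -> : [set w | exists k, F k w] = \bigcup_k F k.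
  by apply/seteqP; split=> w [k]; exists k.
exact: h.
Qed.

Lemma sigma_bigcap (F : nat -> set T) : (forall k, S (F k)) ->
  S [set w | forall k, F k w].
Proof.
move=> SF; rewrite -[X in S X]setCK; apply: sigmaC.
have -> : ~` [set w | forall k, F k w] = [set w | exists k, (~` F k) w].
  by apply/seteqP; split=> w /=; [move/existsNP|move=> h; apply/existsNP].
by apply: sigma_bigcup => k; exact: sigmaC.
Qed.

Lemma sigma0 : S set0. Proof. by case: sS. Qed.

Lemma sigmaT : S setT. Proof. by rewrite -setC0; apply: sigmaC; exact: sigma0. Qed.

Lemma sigmaI A B : S A -> S B -> S (A `&` B).
Proof.
move=> SA SB; have -> : A `&` B = [set w | forall k, (if k is 0%N then A else B) w].
  by apply/seteqP; split=> w /= => [[a b] [|k]//|h]; split; [exact: (h 0%N)|exact: (h 1%N)].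
by apply: sigma_bigcap => -[].
Qed.

Lemma sigmaU A B : S A -> S B -> S (A `|` B).
Proof.
by move=> SA SB; rewrite -[A `|` B]setCK setCU; apply/sigmaC/sigmaI; exact: sigmaC.
Qed.

Lemma sigma_forall_in {I : eqType} (G : I -> set T) (s : seq I) :
  (forall i, S (G i)) -> S [set w | forall j, j \in s -> G j w].
Proof.
move=> SG; elim: s => [|i s IHs]; first by rewrite setIforall_nil; exact: sigmaT.
by rewrite setIforall_cons; exact: sigmaI.
Qed.

End SigmaAlgebra.

(** * Marks of the points and independent gadgets *)

Section MarkedPoissonProcess.
Context {R : realType} d (T : measurableType d) (P : probability T R).
Context (lambda : R) (X : nat -> T -> R * R) (D : nat -> T -> bool).
Hypothesis XD : marked_poisson_process P lambda X D.
Local Open Scope ereal_scope.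

Lemma sigma_of_sigma : sigma_algebra setT (sigma_of X).
Proof. exact: smallest_sigma_algebra. Qed.

Lemma sigma_of_measurable (E : set T) : sigma_of X E -> measurable E.
Proof.
move=> h; apply: (h measurable); split; first exact: sigma_algebra_measurable.
move=> _ [k [B [mB ->]]]; rewrite -[_ @^-1` _]setTI.
exact: (mpp_measurable_point XD).
Qed.

Lemma sigma_of_point (k : nat) (A : set (R * R)) : measurable A ->
  sigma_of X [set w | A (X k w)].
Proof. by move=> mA; apply: sub_sigma_algebra; exists k, A. Qed.

Lemma measurable_mark k v : measurable [set w | D k w = v].
Proof.
rewrite (_ : [set w | _] = setT `&` D k @^-1` [set v]); last by rewrite setTI.
exact: (mpp_measurable_mark XD k).
Qed.

(** The law of the marks is given only for initial segments of indices. The marks outside [K] are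
    therefore summed out, each one splitting the event into two halves. *)
Lemma marks_half (E : set T) (K : seq nat) (v : bool) :
  sigma_of X E -> uniq K ->
  P (E `&` [set w | forall k, k \in K -> D k w = v]) =
  P E * ((2^-1) ^+ size K)%R%:E.
Proof.
move=> sE uK; set m := (\max_(k <- K) k.+1)%N.
have Km k : k \in K -> (k < m)%N.
  by move=> kK; rewrite /m (big_rem _ kK) /= leq_max leqnn.
(* [W] interpolates: [W m] prescribes every mark below [m], as [mpp_marks] requires, while [W 0]
   prescribes only those of [K]. The induction descends from [n = m] to [n = 0]. *)
pose W n (b : nat -> bool) := E `&`
  [set w | (forall i, (i < n)%N -> D i w = b i) /\
           (forall k, k \in K -> (n <= k)%N -> D k w = v)].
have mE := sigma_of_measurable sE.
have mW n b : measurable (W n b).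
  have -> : W n b = E `&` ([set w | forall i, i \in iota 0 n -> D i w = b i] `&`
      [set w | forall k, k \in [seq k <- K | (n <= k)%N] -> D k w = v]).
    congr (_ `&` _); apply/seteqP; split=> w /= [h1 h2]; split=> i.
    - by rewrite mem_iota => /andP[_]; exact: h1.
    - by rewrite mem_filter => /andP[? ?]; exact: h2.
    - by move=> ni; apply: h1; rewrite mem_iota.
    - by move=> iK ni; apply: h2; rewrite mem_filter ni.
  apply: measurableI => //; apply: measurableI; apply: measurable_forall_in => i _;
    exact: measurable_mark.
suff W_ q n b : (n + q = m)%N ->
    P (W n b) = P E * ((2^-1) ^+ (n + count (fun k => n <= k)%N K))%R%:E.
  have := W_ m 0%N (fun=> v) (add0n _).
  rewrite add0n (@eq_count _ _ predT)// count_predT => <-.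
  congr (P (_ `&` _)); apply/seteqP; split=> w /=.
    by move=> h; split=> // k kK _; exact: h.
  by move=> [_ h] k kK; exact: h.
elim: q n b => [|q IHq] n b nq.
  rewrite addn0 in nq; rewrite nq; have -> : count (fun k => m <= k)%N K = 0%N.
    by apply/eqP; rewrite -leqn0 leqNgt -has_count; apply/hasPn => k /Km; rewrite ltnNge.
  rewrite addn0 -(mpp_marks XD (fun i : 'I_m => b i) sE); congr (P (_ `&` _)).
  apply/seteqP; split=> w /=.
    by move=> [h _] i _; exact: h.
  move=> h; split=> [i im|k /Km mk]; first exact: (h (Ordinal im) I).
  by rewrite leqNgt mk.
have nq' : (n.+1 + q = m)%N by rewrite addSnnS.
pose upd b0 := fun i => if i == n then b0 else b i.
have Wupd b0 : (n \in K -> b0 = v) ->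
    W n.+1 (upd b0) = W n b `&` [set w | D n w = b0].
  move=> b0v; apply/seteqP; split=> w /=.
    move=> [Ew [h1 h2]]; have Dn : D n w = b0 by rewrite h1// /upd eqxx.
    split=> //; split=> //; split=> [i ni|k kK].
      by rewrite h1 ?(leqW ni)// /upd ltn_eqF.
    rewrite leq_eqVlt => /predU1P[nk|]; first by move: kK; rewrite -nk Dn => /b0v.
    exact: h2.
  move=> [[Ew [h1 h2]] Dn]; split=> //; split=> [i|k kK /ltnW]; last exact: h2.
  rewrite ltnS leq_eqVlt /upd => /predU1P[->|ni]; first by rewrite eqxx.
  by rewrite ltn_eqF// h1.
have cntE : count (fun k => n <= k)%N K = ((n \in K) + count (fun k => n < k)%N K)%N.
  rewrite -(count_uniq_mem _ uK); elim: (K) => //= k s ->.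
  by case: (ltngtP n k); lia.
have [nK|nK] := boolP (n \in K).
  have -> : W n b = W n.+1 (upd v).
    by rewrite Wupd//; apply/seteqP; split=> [w Ww|w []//]; split=> //; apply Ww.
  by rewrite IHq// cntE nK addSnnS.
(* A free index takes both values, and the two halves add up to the weight of the unconstrained
   event. *)
have Wsplit : W n b = W n.+1 (upd true) `|` W n.+1 (upd false).
  rewrite !Wupd; last 2 first.
  - by move=> nK'; rewrite nK' in nK.
  - by move=> nK'; rewrite nK' in nK.
  apply/seteqP; split=> [w Ww|w [[]|[]]//].
  by case Dn: (D n w); [left|right].
have -> : P (W n b) = P (W n.+1 (upd true)) + P (W n.+1 (upd false)).
  rewrite Wsplit; apply: measureU => //.
  apply/seteqP; split=> // w [[_ [h1 _]] [_ [h2 _]]].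
  by have := h1 n (leqnn _); rewrite h2// /upd eqxx.
rewrite !IHq// cntE (negbTE nK) add0n addSn exprS.
rewrite -(fineK (fin_num_measure P _ mE)) -!EFinM -EFinD; congr (_%:E).
lra.
Qed.

Definition first_in (c : set (R * R)) k : set T :=
  [set w | c (X k w) /\ forall j, (j < k)%N -> ~ c (X j w)].

(* The mark of the point of [c] with the least index: almost surely the only
   point when there is just one, but with no null set to discard. *)
Definition first_mark (c : set (R * R)) (v : bool) : set T :=
  [set w | exists k, first_in c k w /\ D k w = v].

Lemma sigma_of_first_in c k : measurable c -> sigma_of X (first_in c k).
Proof.
move=> mc; have -> : first_in c k = [set w | c (X k w)] `&`
    [set w | forall j, j \in iota 0 k -> (~` [set w | c (X j w)]) w].
  apply/seteqP; split=> w /= [cw h]; split=> // j; have := h j;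
    by rewrite mem_iota.
apply: (sigmaI sigma_of_sigma); first exact: sigma_of_point.
apply: (sigma_forall_in sigma_of_sigma) => j.
by apply: (sigmaC sigma_of_sigma); exact: sigma_of_point.
Qed.

Lemma trivIset_first_in c : trivIset setT (first_in c).
Proof.
move=> i j _ _ [w [[ci hi] [cj hj]]].
by have [/hj|/hi|//] := ltngtP i j; last by case.
Qed.

Lemma measurable_first_mark c v : measurable c -> measurable (first_mark c v).
Proof.
move=> mc; apply: (sigma_bigcup (sigma_algebra_measurable T)) => k.
apply: measurableI; last exact: measurable_mark.
by apply: sigma_of_measurable; exact: sigma_of_first_in.
Qed.

Lemma measure_first_in (E : set T) c : measurable c -> measurable E ->
  (forall w, E w -> exists k, c (X k w)) ->
  P E = \sum_(0 <= k <oo) P (E `&` first_in c k).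
Proof.
move=> mc mE Ec; rewrite -measure_semi_bigcup.
- congr (P _); apply/seteqP; split=> [w Ew|w [k _ []//]].
  have Ew' := Ec w Ew.
  have ex : exists k, `[< c (X k w) >] by case: Ew' => k ck; exists k; apply/asboolP.
  exists (ex_minn ex) => //; split=> //; case: ex_minnP => k /asboolP ck kmin.
  by split=> // j jk /asboolP /kmin; rewrite leqNgt jk.
- by move=> k; apply: measurableI => //; apply: sigma_of_measurable; exact: sigma_of_first_in.
- by apply: trivIset_setIl; exact: trivIset_first_in.
- apply: bigcup_measurable => k _; apply: measurableI => //.
  by apply: sigma_of_measurable; exact: sigma_of_first_in.
Qed.

(* The indices in [K] carry the marks that are already prescribed: conditioning
   on which point comes first in the next set adds one more index to [K]. *)
Lemma first_marks_half_aux {I : eqType} (c : I -> set (R * R)) (v : bool)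
    (ls : seq I) (E : set T) (K : seq nat) :
  (forall l, measurable (c l)) -> trivIset setT c -> uniq ls -> uniq K ->
  sigma_of X E ->
  (forall w l, E w -> l \in ls -> exists k, c l (X k w)) ->
  (forall w k l, E w -> k \in K -> l \in ls -> ~ c l (X k w)) ->
  P (E `&` [set w | forall k, k \in K -> D k w = v] `&`
     [set w | forall l, l \in ls -> first_mark (c l) v w]) =
  P E * ((2^-1) ^+ (size K + size ls))%R%:E.
Proof.
move=> mc tc; elim: ls E K => [|l ls IHls] E K.
  by rewrite setIforall_nil setIT addn0 => _ uK sE _ _; exact: marks_half.
move=> /= /andP[lls uls] uK sE Ec EK.
have mD (K' : seq nat) : measurable [set w | forall k, k \in K' -> D k w = v].
  by apply: measurable_forall_in => k _; exact: measurable_mark.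
rewrite (@measure_first_in _ (c l))//; first last.
- by move=> w [[Ew _] _]; apply: (Ec w l Ew); rewrite mem_head.
- apply: measurableI; first by apply: measurableI => //; exact: sigma_of_measurable.
  by apply: measurable_forall_in => l' _; exact: measurable_first_mark.
rewrite (@measure_first_in E (c l))//; first last.
- by move=> w Ew; apply: (Ec w l Ew); rewrite mem_head.
- exact: sigma_of_measurable.
rewrite muleC -nneseriesZl//; apply: eq_eseriesr => k _; rewrite muleC.
(* A point with index in [K] avoids the remaining sets, so it cannot be the first one in [c l]: both
   terms vanish. *)
have [kK|kK] := boolP (k \in K).
  have E0 : E `&` first_in (c l) k = set0.
    apply/seteqP; split=> // w [Ew [cw _]].
    by apply: (EK w k l Ew kK) => //; rewrite mem_head.
  rewrite E0 measure0 mul0e -(measure0 P); congr (P _); apply/seteqP; split=> // w.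
  by move=> [[[Ew _] _] fw]; rewrite -E0.
rewrite -addSnnS -(IHls (E `&` first_in (c l) k) (k :: K))//.
- congr (P _); apply/seteqP; split=> w /=.
    move=> [[[Ew h1] h2] fw]; split; last first.
      by move=> l' l's; apply: h2; rewrite inE l's orbT.
    split=> // k'; rewrite inE => /predU1P[->|]; last exact: h1.
    have [k'' [fk'' <-]] := h2 l (mem_head _ _).
    by congr (D _ _); apply: (@trivIset_first_in (c l)) => //; exists w.
  move=> [[[Ew fw] h1] h2]; split=> //; split.
    by split=> // k' k'K; apply: h1; rewrite inE k'K orbT.
  move=> l'; rewrite inE => /predU1P[->|]; last exact: h2.
  by exists k; split=> //; apply: h1; rewrite mem_head.
- by rewrite /= kK.
- by apply: (sigmaI sigma_of_sigma) => //; exact: sigma_of_first_in.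
- by move=> w l' [Ew _] l's; apply: (Ec w l' Ew); rewrite inE l's orbT.
(* Disjointness keeps the invariant: the point [X k] lies in [c l], hence in no other set of the
   family. *)
- move=> w k' l' [Ew [ck _]]; rewrite inE => /predU1P[->|k'K] l's.
    move=> cl'; move/negP: lls; apply; suff -> : l = l' by [].
    by apply: tc => //; exists (X k w).
  by apply: (EK w k' l' Ew k'K); rewrite inE l's orbT.
Qed.

Lemma first_marks_half {I : eqType} (c : I -> set (R * R)) (v : bool)
    (ls : seq I) (E : set T) :
  (forall l, measurable (c l)) -> trivIset setT c -> uniq ls ->
  sigma_of X E ->
  (forall w l, E w -> l \in ls -> exists k, c l (X k w)) ->
  P (E `&` [set w | forall l, l \in ls -> first_mark (c l) v w]) =
  P E * ((2^-1) ^+ size ls)%R%:E.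
Proof.
move=> mc tc uls sE Ec.
rewrite -(@first_marks_half_aux _ c v ls E [::])//.
by congr (P (_ `&` _)); apply/seteqP; split=> [w Ew|w []].
Qed.

(** Indices are counted rather than points of the range, so that the event belongs to [sigma_of X]
    without exception. Both counts agree wherever [X] is injective. *)
Definition ncount (A : set (R * R)) (n : nat) : set T :=
  [set w | counting [set k | A (X k w)] = n%:R%:E :> \bar R].

(** The count among the first [m] points is handled by recursion on [m]; the full count equals [n]
    when these partial counts are eventually [n]. *)
Lemma sigma_of_ncount A n : measurable A -> sigma_of X (ncount A n).
Proof.
move=> mA; pose S m n := [set w | count (fun k => `[< A (X k w) >]) (iota 0 m) = n].
have sS m : forall n, sigma_of X (S m n).
  elim: m => [|m IHm] n'.
    have [->|n0] := eqVneq n' 0%N.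
      have -> : S 0%N 0%N = setT by apply/seteqP; split.
      exact: (sigmaT sigma_of_sigma).
    have -> : S 0%N n' = set0.
      by apply/seteqP; split=> // w; rewrite /S/= => /esym/eqP; rewrite (negbTE n0).
    exact: (sigma0 sigma_of_sigma).
  have E w : count (fun k => `[< A (X k w) >]) (iota 0 m.+1) =
      (count (fun k => `[< A (X k w) >]) (iota 0 m) + `[< A (X m w) >])%N.
    by rewrite -addn1 iotaD count_cat /= add0n addn0.
  have -> : S m.+1 n' = ([set w | A (X m w)] `&`
        (if n' is n1.+1 then S m n1 else set0)) `|`
      ((~` [set w | A (X m w)]) `&` S m n').
    apply/seteqP; split=> w; rewrite /S /setU /setI /setC /mkset E.
      have [Aw|Aw] := pselect (A (X m w)).
        by rewrite asboolT// addn1 => <-; left.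
      by rewrite asboolF// addn0 => <-; right.
    by case=> -[Aw]; [rewrite asboolT//; case: (n') => // n1 <-; rewrite addn1|
      rewrite asboolF// addn0].
  have sA : sigma_of X [set w | A (X m w)] by exact: sigma_of_point.
  apply: (sigmaU sigma_of_sigma); apply: (sigmaI sigma_of_sigma) => //;
    last exact: (sigmaC sigma_of_sigma).
    by case: (n') => // *; exact: (sigma0 sigma_of_sigma).
have -> : ncount A n = [set w | exists M, [set w | forall m,
    [set w | (M <= m)%N -> S m n w] w] w].
  apply/seteqP; split=> w; rewrite /ncount /mkset => h.
    by have /counting_natP := h.
  by apply/counting_natP.
apply: (sigma_bigcup sigma_of_sigma) => M; apply: (sigma_bigcap sigma_of_sigma) => m.
have [Mm|Mm] := boolP (M <= m)%N.
  have -> : [set w | true -> S m n w] = S m n.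
    by apply/seteqP; split=> w //= /(_ isT).
  exact: sS.
have -> : [set w | false -> S m n w] = setT by apply/seteqP; split.
exact: (sigmaT sigma_of_sigma).
Qed.

Lemma measurable_ncount A n : measurable A -> measurable (ncount A n).
Proof. by move=> mA; apply: sigma_of_measurable; exact: sigma_of_ncount. Qed.

Lemma measure_eq_off_null (A B Z : set T) : measurable A -> measurable B ->
  measurable Z -> P Z = 0 -> (forall w, ~ Z w -> A w <-> B w) -> P A = P B.
Proof.
move=> mA mB mZ PZ AB.
have H (C : set T) : measurable C -> P C = P (C `\` Z).
  move=> mC; have PCZ : P (C `&` Z) = 0.
    by apply/eqP; rewrite -measure_le0 -PZ measureIr.
  have : P C = P (C `\` Z) + P (C `&` Z) by exact: measureDI.
  by rewrite PCZ adde0.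
rewrite H// [RHS]H//; congr (P _); apply/seteqP; split=> w [Aw Zw]; split=> //;
  exact/AB.
Qed.

Definition poisson_weight (m : R) (n : nat) : R := expR (- m) * m ^+ n / n`!%:R.

Lemma counting_range (A : set (R * R)) w : injective (X ^~ w) ->
  counting (range (X ^~ w) `&` A) = counting [set k | A (X k w)] :> \bar R.
Proof.
move=> inj; rewrite -(@counting_image _ _ _ (X ^~ w)).
  congr counting; apply/seteqP; split=> z /=.
    by move=> [[k _ <-] Az]; exists k.
  by move=> [k Ak <-]; split=> //; exists k.
by move=> i j _ _; exact: inj.
Qed.

(** Off the null set where [X] is not injective, counts of indices are counts of points, to which
    the independence and the law of the Poisson process apply. *)
Lemma ncount_indep {I : eqType} (A : I -> set (R * R)) (n : I -> nat) (s : seq I) :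
  (forall i, measurable (A i)) -> (forall i, area (A i) < +oo) ->
  trivIset setT A -> uniq s ->
  P [set w | forall i, i \in s -> ncount (A i) (n i) w] =
  (\prod_(i <- s) poisson_weight (lambda * fine (area (A i))) (n i))%R%:E.
Proof.
move=> mA aA tA us; pose t := in_tuple s.
have [Z [mZ PZ hZ]] := mpp_injective XD.
have iZ w : ~ Z w -> injective (X ^~ w).
  by move=> nZ; apply: contrapT => ni; apply: nZ; exact: hZ.
pose V w := range (X ^~ w).
have mV i m : measurable [set w | counting (V w `&` A i) = m%:R%:E :> \bar R].
  rewrite (_ : [set w | _] =
    setT `&` (fun w => counting (V w `&` A i) : \bar R) @^-1` [set m%:R%:E]).
    exact: (poisson_process_measurable (mpp_poisson XD)).
  by rewrite setTI.
have -> : P [set w | forall i, i \in s -> ncount (A i) (n i) w] =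
    P (\bigcap_(i in [set: 'I_(size s)])
      [set w | counting (V w `&` A (tnth t i)) = (n (tnth t i))%:R%:E :> \bar R]).
  apply: (@measure_eq_off_null _ _ Z) => //.
  - by apply: measurable_forall_in => i _; exact: measurable_ncount.
  - by apply: fin_bigcap_measurable => // i _; exact: mV.
  move=> w /iZ inj; split=> /= h.
    by move=> i _ /=; rewrite counting_range//; apply: h; exact: mem_tnth.
  move=> i /(@tnthP _ _ t)[j ->]; by have := h j Logic.I; rewrite /= counting_range.
rewrite (poisson_process_indep (mpp_poisson XD) (fun i => n (tnth t i)))//.
- rewrite (big_tnth _ _ s) -prodEFin; apply: eq_bigr => i _.
  exact: (poisson_process_law (mpp_poisson XD)).
- by move=> i j _ _ /(tA _ _ Logic.I Logic.I) /(tuple_uniqP t us).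
Qed.

(** Passing from [A] to the part of [A] outside [G i] multiplies its measure by [1 - p i] and
    preserves the product formula for the other events. Hence the induction generalizes over [A]. *)
Lemma indep_compl (G : nat -> set T) (p : nat -> R) (s : seq nat) (A : set T) :
  (forall i, measurable (G i)) -> measurable A -> uniq s ->
  (forall t, uniq t -> {subset t <= s} ->
    P (A `&` [set w | forall i, i \in t -> G i w]) = P A * (\prod_(i <- t) p i)%R%:E) ->
  P (A `&` [set w | forall i, i \in s -> ~ G i w]) =
  P A * (\prod_(i <- s) (1 - p i))%R%:E.
Proof.
move=> mG; elim: s A => [|i s IHs] A mA.
  by move=> _ _; rewrite setIforall_nil setIT big_nil mule1.
move=> /= /andP[iS us] H.
have PD (B : set T) : measurable B -> P (B `&` ~` G i) = P B - P (B `&` G i).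
  by move=> mB; rewrite -setDE; apply: measureD => //; rewrite ltey_eq fin_num_measure.
have PA : P (A `&` ~` G i) = P A * (1 - p i)%R%:E.
  rewrite PD//; have := H [:: i]; rewrite setIforall_cons setIforall_nil setIT.
  rewrite big_seq1 => ->//; first last.
    by move=> j; rewrite !inE => ->.
  by rewrite -(fineK (fin_num_measure P _ mA)) -!EFinM -EFinB mulrBr mulr1.
have -> : [set w | forall j, j \in i :: s -> ~ G j w] =
    ~` G i `&` [set w | forall j, j \in s -> ~ G j w].
  exact: (setIforall_cons (fun j => ~` G j)).
rewrite setIA IHs//; first by rewrite PA big_cons EFinM muleA.
  by apply: measurableI => //; exact: measurableC.
move=> t ut ts.
have mt : measurable [set w | forall j, j \in t -> G j w].
  by apply: measurable_forall_in => j _; exact: mG.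
rewrite setIAC PD ?PA; last exact: measurableI.
have it : i \notin t by apply: contra iS => /ts.
rewrite H//; last by move=> j /ts js; rewrite inE js orbT.
have := H (i :: t); rewrite setIforall_cons big_cons [G i `&` _]setIC setIA => ->.
- rewrite -(fineK (fin_num_measure P _ mA)) -!EFinM -EFinB; congr (_%:E).
  ring.
- by rewrite /= it.
- by move=> j; rewrite !inE => /predU1P[->|/ts ->]; rewrite ?eqxx ?orbT.
Qed.

Definition gadget (c h : set (R * R)) (v : bool) : set T :=
  ncount c 1 `&` ncount h 0 `&` first_mark c v.

Lemma measurable_gadget c h v : measurable c -> measurable h ->
  measurable (gadget c h v).
Proof.
move=> mc mh; apply: measurableI; last exact: measurable_first_mark.
by apply: measurableI; exact: measurable_ncount.
Qed.

Lemma ncount1_hit c w : ncount c 1 w -> exists k, c (X k w).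
Proof.
move=> h; apply: contrapT => nk; move: h; rewrite /ncount /=.
have -> : [set k | c (X k w)] = [set` [::]].
  by apply/seteqP; split=> k // ck; exfalso; apply: nk; exists k.
by rewrite counting_seq// => -[/eqP]; rewrite eqr_nat.
Qed.

(** * Independence of disjoint gadgets *)

Section Gadgets.
Context (Q : set (R * R)) (c h : nat -> set (R * R)).
(** Packing [Q], the cells and the halos into one family lets a single disjointness hypothesis and a
    single use of [ncount_indep] cover them all. *)
Let A (o : option (nat * bool)) : set (R * R) :=
  match o with None => Q | Some (l, true) => c l | Some (l, false) => h l end.
Hypotheses (mA : forall o, measurable (A o)) (aA : forall o, area (A o) < +oo)
  (tA : trivIset setT A).

Let weight B n := poisson_weight (lambda * fine (area B)) n.

Definition gadget_weight c h := (2^-1 * weight c 1 * weight h 0)%R.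

(** The counts come first: they are independent by disjointness and form an event of [sigma_of X].
    On that event every cell of the list holds a point, so the marks contribute one factor one half
    per cell. *)
Lemma gadgets_indep (v : bool) (n : nat) (ls : seq nat) : uniq ls ->
  P (ncount Q n `&` [set w | forall l, l \in ls -> gadget (c l) (h l) v w]) =
  (weight Q n * \prod_(l <- ls) gadget_weight (c l) (h l))%R%:E.
Proof.
move=> uls.
pose s : seq (option (nat * bool)) := None ::
  [seq Some (l, true) | l <- ls] ++ [seq Some (l, false) | l <- ls].
pose m (o : option (nat * bool)) := match o with
  | None => n | Some (l, true) => 1%N | Some (l, false) => 0%N end.
have us : uniq s.
  rewrite /s /= mem_cat cat_uniq !map_inj_uniq ?uls//=; try by move=> i j [].
  rewrite andbT; apply/andP; split.
    by apply/negP => /orP[] /mapP[].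
  by apply/hasPn => _ /mapP[l _ ->]; apply/negP => /mapP[].
pose E := [set w | forall o, o \in s -> ncount (A o) (m o) w].
have sE : sigma_of X E.
  by apply: (sigma_forall_in sigma_of_sigma) => o; exact: sigma_of_ncount.
have EE : ncount Q n `&` [set w | forall l, l \in ls -> gadget (c l) (h l) v w] =
    E `&` [set w | forall l, l \in ls -> first_mark (c l) v w].
  apply/seteqP; split=> w /=.
    move=> [Qw hw]; split; last by move=> l /hw[].
    move=> o; rewrite inE => /predU1P[->//|]; rewrite mem_cat.
    by move=> /orP[] /mapP[l /hw[[cl hl] _] ->].
  move=> [Ew hw]; split.
    by apply: (Ew None); rewrite mem_head.
  move=> l ll; split; last exact: hw.
  split.
    by apply: (Ew (Some (l, true))); rewrite inE mem_cat map_f ?orbT.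
  by apply: (Ew (Some (l, false))); rewrite inE mem_cat (map_f (fun l => Some (l, false))) ?orbT.
rewrite EE first_marks_half//; first last.
- move=> w l Ew ll; apply: ncount1_hit; apply: (Ew (Some (l, true))).
  by rewrite inE mem_cat map_f ?orbT.
- by move=> i j _ _ /(@tA (Some (i, true)) (Some (j, true)) I I)[].
- by move=> l; exact: (mA (Some (l, true))).
have Eprob : P E = (weight Q n * (\prod_(l <- ls) weight (c l) 1 *
    \prod_(l <- ls) weight (h l) 0))%R%:E.
  rewrite /E (ncount_indep m mA aA tA us) /s big_cons big_cat !big_map.
  by [].
rewrite Eprob -EFinM -mulrA; congr ((_ * _)%R%:E).
have halves : forall a b : nat -> R, (\prod_(l <- ls) a l * \prod_(l <- ls) b l *
    2^-1 ^+ size ls = \prod_(l <- ls) (2^-1 * a l * b l))%R.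
  move=> a b; elim: (ls) => [|l s' IHs]; first by rewrite !big_nil expr0 !mulr1.
  by rewrite !big_cons -IHs /= exprS; ring.
exact: halves.
Qed.

Lemma no_gadget (v : bool) (n m : nat) :
  P (ncount Q n `&` [set w | forall l, l \in iota 0 m -> ~ gadget (c l) (h l) v w]) =
  (weight Q n * \prod_(l <- iota 0 m) (1 - gadget_weight (c l) (h l)))%R%:E.
Proof.
have PQ : P (ncount Q n) = (weight Q n)%:E.
  have := gadgets_indep v n (isT : uniq [::]).
  by rewrite setIforall_nil setIT big_nil mulr1.
rewrite (indep_compl (p := fun l => gadget_weight (c l) (h l))) ?iota_uniq//.
- by rewrite PQ.
- by move=> l; apply: measurable_gadget;
    [exact: (mA (Some (l, true)))|exact: (mA (Some (l, false)))].
- exact: (measurable_ncount _ (mA None)).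
- by move=> t ut _; rewrite gadgets_indep// PQ.
Qed.

End Gadgets.

End MarkedPoissonProcess.

(** * Blocking and escaping rays *)

Section Geometry.
Context {R : realType}.

Definition cell (e x y : R) : set (R * R) := `[x, x + e[ `*` `[y, y + e[.

Definition block (e x y : R) : set (R * R) :=
  `[x - e, x + e + e[ `*` `[y - e, y + e + e[.

Lemma cellE e x y z :
  cell e x y z <-> (x <= z.1 < x + e) /\ (y <= z.2 < y + e).
Proof. by rewrite /cell /setX /= !in_itv. Qed.

Lemma blockE e x y z :
  block e x y z <-> (x - e <= z.1 < x + e + e) /\ (y - e <= z.2 < y + e + e).
Proof. by rewrite /block /setX /= !in_itv. Qed.

Lemma squareE (N : R) z : square N z <-> (0 <= z.1 <= N) /\ (0 <= z.2 <= N).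
Proof. by rewrite /square /setX /= !in_itv. Qed.

Lemma border_square_interior (N : R) z :
  0 < z.1 < N -> 0 < z.2 < N -> ~ border (square N) z.
Proof.
move=> z1 z2 [_]; apply.
apply/nbhs_ballP.
exists (Num.min (Num.min z.1 (N - z.1)) (Num.min z.2 (N - z.2))) => /=.
  by rewrite !lt_min; lra.
move=> u; rewrite /ball /= /prod_ball -!ball_normE /= !lt_min !ltr_norml.
by move=> [h1 h2]; apply/squareE; lra.
Qed.

Lemma border_square_right (N y : R) : 0 < N -> 0 <= y <= N ->
  border (square N) (N, y).
Proof.
move=> N0 yN; split; first by apply: subset_closure; apply/squareE; split=> /=; lra.
move=> /nbhs_ballP[e /= e0 he].
have /he /squareE/= : ball (N, y) e (N + e / 2, y).
  by split; rewrite -ball_normE /= ltr_norml; lra.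
lra.
Qed.

(* A ray that meets another one before time [e] was born within distance [e] of
   the meeting point. *)
Lemma isolated_ray_le (c : set ((R * R) * bool)) tau r (e x y s : R) :
  stopping_times c tau -> rays_of c r ->
  (forall m, c m -> block e x y m.1 -> m.1 = base r) ->
  s <= e -> (forall t, 0 <= t < s -> cell e x y (tip r t)) ->
  (s%:E <= tau r)%E.
Proof.
move=> ct cr iso se hs; rewrite ct//; apply: le_ereal_inf_tmp => _ [t ht <-].
rewrite lee_fin leNgt; apply/negP => ts.
case: ht => t0 [r' [cr' br [s' [/andP[s0 s't] _] E]]]; apply: br.
have := hs t; rewrite t0 ts -E => /(_ isT) /cellE.
case: r' cr' E => [[[a b] d'] b'] cr' _; rewrite /tip /base /dirv /= => -[h1 h2].
apply: (iso _ cr'); apply/blockE; move: h1 h2.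
by case: d' {cr'}; case: b' => /=; rewrite ?expr0 ?expr1; split; lra.
Qed.

(** The ray of [v] that faces the line of the given ray crosses it before time [e], while the given
    ray needs at least time [e] to get there. It thus stops at the crossing point at the latest. *)
Lemma blocked_not_escaping (N : R) (c : set ((R * R) * bool)) (u v : R * R)
    (d b : bool) (e x y : R) :
  finite_set c -> c (u, d) -> c (v, ~~ d) ->
  0 < u.1 < N -> 0 < u.2 < N -> 0 < v.1 < N -> 0 < v.2 < N ->
  cell e x y v -> (forall m, c m -> block e x y m.1 -> m.1 = v) ->
  (if d then y <= u.2 < y + e else x <= u.1 < x + e) ->
  (let a := if d then u.1 else u.2 in let a' := if d then v.1 else v.2 in
   if b then a' + e <= a else a + e <= a') ->
  ~ escaping_rays N c (u, d, b).
Proof.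
move=> fc cu cv u1 u2 v1 v2 /cellE[vx vy] iso row dist.
have ct := stop_timeP fc.
(* The crossing point of the line carrying the ray with the orthogonal line through [v]. *)
pose q := if d then (v.1, u.2) else (u.1, v.2).
(* [b'] selects the ray of [v] that faces [q], and [s'] is its arrival time there; the sign of [D]
   below decides between the two rays. *)
suff H b' s' : 0 <= s' -> tip (v, ~~ d, b') s' = q -> ~ escaping_rays N c (u, d, b).
  pose D := if d then u.2 - v.2 else u.1 - v.1.
  have [D0|/ltW D0] := leP 0 D; [apply: (H false D) => //|apply: (H true (- D));
    first by rewrite oppr_ge0].
  - rewrite /D /q /tip /base /dirv /=.
    by case: (d) => /=; rewrite expr0; congr pair; ring.
  - rewrite /D /q /tip /base /dirv /=.
    by case: (d) => /=; rewrite expr1; congr pair; ring.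
move=> s'0 s'q [_ [z [[s [/andP[s0 sN] st] <-]]]].
have s'e : s' < e.
  by move: s'q row; rewrite /q /tip /base /dirv /=; case: (d); case: (b') => /=;
    rewrite ?expr0 ?expr1 => -[? ?] ?; lra.
have s'tau : (s'%:E <= stop_time c (v, ~~ d, b'))%E.
  apply: (@isolated_ray_le c _ _ e x y) => //; first exact: ltW.
  move=> t ht; apply/cellE; move: s'q row; rewrite /q /tip /base /dirv /=.
  by case: (d); case: (b') => /=; rewrite ?expr0 ?expr1 => -[? ?] ?; split; lra.
(* The time at which the ray of [u], if not stopped earlier, reaches [q]. *)
pose T := (-1) ^+ b * (if d then v.1 - u.1 else v.2 - u.2).
have Te : e <= T.
  by move: dist; rewrite /T; case: (d); case: (b) => /=; rewrite ?expr0 ?expr1; lra.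
have Tq : tip (u, d, b) T = q.
  rewrite /T /q /tip /base /dirv /=; case: (d); case: (b) => /=;
    rewrite ?expr0 ?expr1; congr pair; ring.
have tauT : (stop_time c (u, d, b) <= T%:E)%E.
  rewrite ct//; apply: ereal_inf_lbound; exists T => //; split; first lra.
  exists (v, ~~ d, b'); split=> //.
    rewrite /base /= => vu; move: dist; rewrite vu /=.
    by case: (d); case: (b); lra.
  by exists s'; [split=> //; lra|rewrite Tq].
have sT : s <= T by rewrite -lee_fin (le_trans st).
(* The tip remains between [u] and [q], which are both strictly inside the square. *)
apply: border_square_interior; move: dist sT; rewrite /T /tip /base /dirv /=;
  by case: (d); case: (b) => /=; rewrite ?expr0 ?expr1; lra.
Qed.

(** The cell touches the right side of the square, so the ray pointing right stays in its own cell
    until it reaches the border, and nothing can stop it there. *)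
Lemma isolated_escaping (N : R) (c : set ((R * R) * bool)) (v : R * R) (e x y : R) :
  finite_set c -> c (v, true) -> cell e x y v ->
  (forall m, c m -> block e x y m.1 -> m.1 = v) ->
  0 < e <= N -> x + e = N -> 0 <= y -> y + e <= N ->
  escaping_rays N c (v, true, false).
Proof.
move=> fc cv /cellE[vx vy] iso e0N xe y0 ye; split=> //.
exists (N, v.2); split; last by apply: border_square_right; lra.
exists (N - v.1).
  split; first lra.
  apply: (@isolated_ray_le c _ _ e x y) => //; first exact: stop_timeP.
    lra.
  move=> t ht; apply/cellE; rewrite /tip /base /dirv /= expr0; split; lra.
by rewrite /tip /base /dirv /= expr0; congr pair; ring.
Qed.
End Geometry.

(** * Probability estimates *)

Section Areas.
Context {R : realType}.
Local Open Scope ereal_scope.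

Lemma area_rectangle (i j : interval R) :
  area ([set` i] `*` [set` j]) = lebesgue_measure [set` i] * lebesgue_measure [set` j].
Proof. by rewrite /area product_measure1E. Qed.

Lemma area_cell (e x y : R) : (0 < e)%R -> area (cell e x y) = (e ^+ 2)%:E.
Proof.
move=> e0; rewrite area_rectangle !lebesgue_measure_itv /= !lte_fin !ltrDl e0.
by rewrite -!EFinB -EFinM; congr (_%:E); ring.
Qed.

Lemma area_block (e x y : R) : (0 < e)%R -> area (block e x y) = (9 * e ^+ 2)%:E.
Proof.
move=> e0; rewrite area_rectangle !lebesgue_measure_itv /= !lte_fin.
have -> : (x - e < x + e + e)%R by lra.
have -> : (y - e < y + e + e)%R by lra.
by rewrite -!EFinB -EFinM; congr (_%:E); ring.
Qed.

Lemma measurable_cell (e x y : R) : measurable (cell e x y).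
Proof. by apply: measurableX. Qed.

Lemma measurable_block (e x y : R) : measurable (block e x y).
Proof. by apply: measurableX. Qed.

Lemma measurable_square (N : R) : measurable (square N).
Proof. by apply: measurableX. Qed.

Definition halo (e x y : R) := block e x y `\` cell e x y.

Lemma measurable_halo (e x y : R) : measurable (halo e x y).
Proof. by apply: measurableD; [exact: measurable_block|exact: measurable_cell]. Qed.

Lemma area_halo (e x y : R) : (0 < e)%R -> area (halo e x y) = (8 * e ^+ 2)%:E.
Proof.
move=> e0; have cb : block e x y `&` cell e x y = cell e x y.
  by apply: setIidr => z /cellE zc; apply/blockE; lra.
have fb : area (block e x y) < +oo by rewrite area_block ?ltry.
have : area (halo e x y) = area (block e x y) - area (block e x y `&` cell e x y).
  apply: measureD; [exact: measurable_block|exact: measurable_cell|exact: fb].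
by rewrite cb area_block// area_cell// => ->; rewrite -EFinB; congr (_%:E); ring.
Qed.

Lemma area_square (N : R) : (0 < N)%R -> area (square N) = (N ^+ 2)%:E.
Proof.
move=> N0; rewrite area_rectangle !lebesgue_measure_itv /= !lte_fin N0.
by rewrite -!EFinB -EFinM; congr (_%:E); ring.
Qed.

(** The boundary of the square, written as a difference of rectangles to make its area computable.
    Being null, it almost surely contains no point of the process. *)
Definition square_frame (N : R) : set (R * R) :=
  square N `\` (`]0%R, N[ `*` `]0%R, N[).

Lemma measurable_square_frame N : measurable (square_frame N).
Proof. by apply: measurableD; exact: measurableX. Qed.

Lemma area_square_frame (N : R) : (0 < N)%R -> area (square_frame N) = 0.
Proof.
move=> N0; have cb : square N `&` (`]0%R, N[ `*` `]0%R, N[) = `]0%R, N[ `*` `]0%R, N[.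
  by apply: setIidr => z [/=]; rewrite !in_itv /= => h1 h2; apply/squareE; lra.
have fb : area (square N) < +oo by rewrite area_square ?ltry.
have : area (square_frame N) = area (square N) -
    area (square N `&` (`]0%R, N[ `*` `]0%R, N[)).
  apply: measureD; [exact: measurable_square|exact: measurableX|exact: fb].
rewrite cb area_square// area_rectangle !lebesgue_measure_itv /= !lte_fin N0.
by move=> ->; rewrite !sube0 -EFinM -EFinB; congr (_%:E); ring.
Qed.

(** The probability generating function of the Poisson law. At [a = 1] it gives the total mass; at
    [a = 2] it bounds the expected number of points. *)
Lemma poisson_weight_series (a m : R) : (0 <= a)%R -> (0 <= m)%R ->
  \sum_(0 <= n <oo) (a ^+ n * poisson_weight m n)%:E = (expR (a * m - m))%:E.
Proof.
move=> a0 m0.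
have E n : ((a ^+ n * poisson_weight m n)%:E = (expR (- m))%:E * (exp_coeff (a * m) n)%:E).
  by rewrite -EFinM /poisson_weight /exp_coeff /= exprMn; congr (_%:E); ring.
under eq_eseriesr do rewrite E.
rewrite nneseriesZl; last first.
  by move=> n _; rewrite lee_fin exp_coeff_ge0// mulr_ge0.
have -> : expR (a * m - m) = (expR (- m) * expR (a * m))%R by rewrite -expRD addrC.
rewrite EFinM; congr (_ * _).
rewrite /expR -EFin_lim; last exact: is_cvg_series_exp_coeff.
by apply: congr_lim; apply/funext => n /=; rewrite sumEFin.
Qed.

End Areas.

(** * Disjoint blocks ahead of a cell *)

Section BlockFamily.
Context {R : realType}.
Variables (e x y : R) (d b : bool).

(** The offset of the center cell. Block [l] covers the cells numbered [3 l + 1] to [3 l + 3] ahead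
    of the starting cell, so block 0 is adjacent to it and consecutive blocks are adjacent. *)
Definition block_offset (l : nat) : R := (-1) ^+ b * (2 + 3 * l%:R) * e.
Definition cx (l : nat) := if d then x + block_offset l else x.
Definition cy (l : nat) := if d then y else y + block_offset l.

Definition block_family (Q : set (R * R)) (o : option (nat * bool)) : set (R * R) :=
  match o with
  | None => Q
  | Some (l, true) => cell e (cx l) (cy l)
  | Some (l, false) => halo e (cx l) (cy l)
  end.

Lemma trivIset_block_family (Q : set (R * R)) : 0 < e -> Q `<=` cell e x y ->
  trivIset setT (block_family Q).
Proof.
move=> e0 Qc.
have sub l v z : block_family Q (Some (l, v)) z -> block e (cx l) (cy l) z.
  by case: v => [/cellE h|[]//]; apply/blockE; lra.
have Qb l z : Q z -> block e (cx l) (cy l) z -> False.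
  have le0 : 0 <= l%:R * e :> R by rewrite mulr_ge0// ltW.
  move=> /Qc/cellE h1 /blockE; move: h1; rewrite /cx /cy /block_offset.
  by case: (d); case: (b); rewrite ?expr0 ?expr1; lra.
have bb l l' z : (l < l')%N -> block e (cx l) (cy l) z ->
    block e (cx l') (cy l') z -> False.
  move=> ll' /blockE h1 /blockE; move: h1; rewrite /cx /cy /block_offset.
  have : l.+1%:R * e <= l'%:R * e :> R by rewrite ler_pM2r// ler_nat.
  rewrite -natr1 mulrDl.
  by case: (d); case: (b); rewrite ?expr0 ?expr1; lra.
move=> [[l v]|] [[l' v']|] _ _ [z [h1 h2]] //; last 2 first.
- by exfalso; exact: (Qb l z h2 (sub _ _ _ h1)).
- by exfalso; exact: (Qb l' z h1 (sub _ _ _ h2)).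
have [/bb/(_ (sub _ _ _ h1) (sub _ _ _ h2))//|
  /bb/(_ (sub _ _ _ h2) (sub _ _ _ h1))//|ll'] := ltngtP l l'.
move: h1 h2; rewrite -ll' {ll'}.
by case: v; case: v' => //= h1 h2; [case: h2|case: h1].
Qed.

End BlockFamily.

Import HBNNSimple.

(** * Comparison of integrals without measurability *)

Section Integral.
Context {R : realType} d (T : measurableType d) (P : probability T R).
Local Open Scope ereal_scope.

(** This supremum formula holds whether or not [f] is measurable, which spares a measurability proof
    for the number of escaping rays. *)
Lemma integral_nnsfun_sup (f : T -> \bar R) : (forall w, 0 <= f w) ->
  \int[P]_w f w = ereal_sup [set sintegral P h | h in
    [set h : {nnsfun T >-> R} | forall w, (h w)%:E <= f w]].
Proof. by move=> f0; rewrite ge0_integralTE. Qed.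

Lemma le_integral_nonmeasurable (f g : T -> \bar R) : (forall w, 0 <= f w) ->
  (forall w, f w <= g w) -> \int[P]_w f w <= \int[P]_w g w.
Proof.
move=> f0 fg; rewrite !integral_nnsfun_sup//; last first.
  by move=> w; apply: le_trans (fg w).
apply: le_ereal_sup => _ [h hf <-]; exists h => // w.
exact: le_trans (fg w).
Qed.

(** A simple function below [f] is measurable and almost everywhere below [g], so measurability is
    required of [g] alone. *)
Lemma le_integral_off_null (f g : T -> \bar R) (Z : set T) :
  (forall w, 0 <= f w) -> (forall w, 0 <= g w) -> measurable_fun setT g ->
  measurable Z -> P Z = 0 -> (forall w, ~ Z w -> f w <= g w) ->
  \int[P]_w f w <= \int[P]_w g w.
Proof.
move=> f0 g0 mg mZ PZ fg; rewrite integral_nnsfun_sup//.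
apply: ge_ereal_sup => _ [h hf <-]; rewrite -integralT_nnsfun.
apply: ae_ge0_le_integral => //.
- by move=> w _; rewrite lee_fin.
- exact/measurable_EFinP.
exists Z; split=> // w /= hw; apply: contrapT => nZ; apply: hw => _.
exact: le_trans (fg w nZ).
Qed.

End Integral.

Section Estimates.
Context {R : realType} d (T : measurableType d) (P : probability T R).
Context (lambda : R) (X : nat -> T -> R * R) (D : nat -> T -> bool).
Hypothesis XD : marked_poisson_process P lambda X D.
Hypothesis lambda_gt0 : 0 < lambda.
Local Open Scope ereal_scope.

Lemma almost_surely_regular (N : R) : (0 < N)%R -> exists Z : set T,
  [/\ measurable Z, P Z = 0 & forall w, ~ Z w ->
    [/\ injective (X ^~ w), finite_set [set k | square N (X k w)] &
      forall k, square N (X k w) ->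
        (0 < (X k w).1 < N)%R /\ (0 < (X k w).2 < N)%R]].
Proof.
move=> N0; have [Zi [mZi PZi hZi]] := mpp_injective XD.
pose U := [set w | exists n, ncount X (square N) n w].
have mS := measurable_square N.
have mU : measurable U.
  apply: (sigma_bigcup (sigma_algebra_measurable T)) => n.
  exact: (measurable_ncount XD).
have law (A : set (R * R)) n : measurable A -> area A < +oo ->
    P (ncount X A n) = (poisson_weight (lambda * fine (area A)) n)%:E.
  move=> mA aA; have := @ncount_indep _ _ _ _ lambda X D XD unit (fun=> A) (fun=> n) [:: tt].
  rewrite setIforall_cons setIforall_nil setIT big_seq1; apply=> //.
  by move=> [] [].
(* The number of points in the square is almost surely finite: the Poisson weights of the finite
   values sum to one. *)
have PU : P U = 1.
  have -> : U = \bigcup_n ncount X (square N) n.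
    by apply/seteqP; split=> w [n]; exists n.
  rewrite measure_semi_bigcup.
  - have m0 : (0 <= lambda * N ^+ 2)%R by rewrite mulr_ge0 ?sqr_ge0// ltW.
    have := poisson_weight_series (@ler01 R) m0; rewrite mul1r subrr expR0 => <-.
    apply: eq_eseriesr => n _; rewrite expr1n mul1r.
    have := law (square N) n mS; rewrite area_square// ltry.
    by move=> /(_ isT).
  - by move=> n; exact: (measurable_ncount XD).
  - move=> i j _ _ [w []]; rewrite /ncount /= => -> [/eqP].
    by rewrite eqr_nat => /eqP.
  - by apply: bigcup_measurable => n _; exact: (measurable_ncount XD).
pose F := ncount X (square_frame N) 0.
have mF : measurable F by apply: (measurable_ncount XD); exact: measurable_square_frame.
(* A Poisson count of mean zero vanishes almost surely. *)
have PF : P F = 1.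
  rewrite law ?area_square_frame ?ltry//; last exact: measurable_square_frame.
  by rewrite /poisson_weight mulr0 oppr0 expR0 expr0 fact0 !mul1r invr1.
have null_C (A : set T) : measurable A -> P A = 1 -> P (~` A) = 0.
  by move=> mA PA; rewrite probability_setC// PA subee.
have null_U (A B : set T) : measurable A -> measurable B -> P A = 0 -> P B = 0 ->
    P (A `|` B) = 0.
  move=> mA mB PA PB; have : P (A `|` B) <= P A + P B by exact: measureU2.
  by rewrite PA PB adde0 measure_le0 => /eqP.
have mUC := measurableC mU; have mFC := measurableC mF.
have PUC := null_C _ mU PU; have PFC := null_C _ mF PF.
exists (Zi `|` ~` U `|` ~` F); split.
- by apply: measurableU => //; apply: measurableU.
- by apply: (null_U) => //; [exact: measurableU|exact: null_U].
move=> w nZ; have inj : injective (X ^~ w).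
  by apply: contrapT => h; apply: nZ; left; left; exact: hZi.
have /= [n hn] : U w by apply: contrapT => h; apply: nZ; left; right.
have Fw : F w by apply: contrapT => h; apply: nZ; right.
split=> //.
  by apply: contrapT => inf; move: hn; rewrite /ncount /= counting_infinite.
move=> k sk; have nL : ~ square_frame N (X k w).
  move=> Lk.
  suff: (size [:: k] <= 0)%N by [].
  by apply: (size_le_counting _ _ Fw) => // j /=; rewrite inE => /eqP ->.
have : (`]0%R, N[ `*` `]0%R, N[) (X k w).
  by apply: contrapT => h; apply: nL; split.
by move=> [/=]; rewrite !in_itv.
Qed.

(** A point of the block lies in the halo, which is empty, or in the cell, which holds a single
    point. Counting indices makes the index itself unique. *)
Lemma gadget_unique (e x y : R) v w : (0 < e)%R ->
  gadget X D (cell e x y) (halo e x y) v w ->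
  exists k, [/\ cell e x y (X k w), D k w = v &
    forall j, block e x y (X j w) -> j = k].
Proof.
move=> e0 [[c1 h0] [k [[ck _] Dk]]]; exists k; split=> // j bj.
have cj : cell e x y (X j w).
  apply: contrapT => ncj.
  suff: (size [:: j] <= 0)%N by [].
  by apply: (size_le_counting _ _ h0) => // j' /=; rewrite inE => /eqP ->.
apply/eqP; apply: contrapT => jk.
have jk' : uniq [:: j; k] by rewrite /= inE andbT; exact/negP.
suff: (size [:: j; k] <= 1)%N by [].
by apply: (size_le_counting jk' _ c1) => j' /=; rewrite !inE => /orP[] /eqP ->.
Qed.

(** * Estimates when the mean number of points per cell is between 1 and 4 *)

Section Scale.
Variable e : R.
Hypotheses (e_gt0 : (0 < e)%R) (lower_e : (1 <= lambda * e ^+ 2)%R)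
  (upper_e : (lambda * e ^+ 2 <= 4)%R).

(** A uniform lower bound for [gw] below: with [s = lambda * e ^+ 2], the factor [s] is at least 1
    and [9 * s] is at most 36. *)
Definition rho : R := (2^-1 * expR (- 36))%R.

(** The probability of a gadget: one half for the mark, one point in a cell of mean
    [s = lambda * e ^+ 2], none in a halo of mean [8 * s]. *)
Let gw := (2^-1 * (lambda * e ^+ 2 * expR (- (9 * (lambda * e ^+ 2)))))%R.

Lemma gadget_weight_cell x y :
  gadget_weight lambda (cell e x y) (halo e x y) = gw.
Proof.
rewrite /gadget_weight /poisson_weight area_cell// area_halo//= /gw.
rewrite expr1 expr0 fact0 divr1 !mulr1.
have -> : (- (9 * (lambda * e ^+ 2)) =
   - (lambda * e ^+ 2) + - (lambda * (8 * e ^+ 2)))%R by ring.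
rewrite expRD !divr1; ring.
Qed.

Lemma rho_le_gw : (rho <= gw)%R.
Proof.
rewrite /rho /gw ler_pM2l// -[leLHS]mul1r.
apply: ler_pM => //; rewrite ?expR_ge0// ler_expR.
by move: upper_e; set s := (lambda * _)%R => s4; rewrite lerN2; lra.
Qed.

Lemma gw_le1 : (gw <= 1)%R.
Proof.
rewrite /gw expRN; set s := (lambda * e ^+ 2)%R.
have s9 : (1 + 9 * s <= expR (9 * s))%R := expR_ge1Dx _.
have : (s / expR (9 * s) <= 1)%R.
  by rewrite ler_pdivrMr ?expR_gt0//; have := lower_e; rewrite -/s; lra.
lra.
Qed.

Section Family.
Variables (x y : R) (dir b : bool).

Let c l := cell e (cx e x dir b l) (cy e y dir b l).
Let h l := halo e (cx e x dir b l) (cy e y dir b l).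

Lemma measurable_block_family Q o : measurable Q -> measurable (block_family e x y dir b Q o).
Proof.
by case: o => [[l []]|]//= _; [exact: measurable_cell|exact: measurable_halo].
Qed.

Lemma area_block_family Q o : area Q < +oo -> area (block_family e x y dir b Q o) < +oo.
Proof. by case: o => [[l []]|]//= _; rewrite ?area_cell ?area_halo ?ltry. Qed.

Lemma gadget_prob v : P (gadget X D (c 0) (h 0) v) = gw%:E.
Proof.
have a0 : area set0 = 0 :> \bar R by rewrite /area measure0.
(* With [Q] empty, the condition of zero points in [Q] is sure and only the gadget remains. *)
have := @gadgets_indep _ _ _ _ lambda X D XD set0 c h.
move=> /(_ _ _ _ v 0%N [:: 0%N] isT); rewrite setIforall_cons setIforall_nil setIT big_seq1.
rewrite a0 /= /poisson_weight mulr0 oppr0 expR0 expr0 fact0 !mul1r invr1 mul1r.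
rewrite gadget_weight_cell => <-.
- congr (P _); apply/seteqP; split=> w // hw; last by case: hw.
  split=> //; rewrite /ncount /=.
  by rewrite (_ : [set k | _] = [set` [::]]) ?counting_seq//; apply/seteqP; split.
- by move=> o; exact: (measurable_block_family o measurable0).
- by move=> o; apply: (@area_block_family set0 o); rewrite a0 ltry.
- exact: trivIset_block_family.
Qed.

Definition unblocked (m : nat) : set T :=
  [set w | forall l, l \in iota 0 m -> ~ gadget X D (c l) (h l) (~~ dir) w].

Lemma measurable_unblocked m : measurable (unblocked m).
Proof.
apply: (@measurable_forall_in _ _ _ (fun l => ~` gadget X D (c l) (h l) (~~ dir))) => l _.
apply: measurableC; apply: (measurable_gadget XD).
  exact: measurable_cell.
exact: measurable_halo.
Qed.

Lemma unblocked_prob m n :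
  P (ncount X (cell e x y) n `&` unblocked m) =
  (poisson_weight (lambda * e ^+ 2) n * (1 - gw) ^+ m)%R%:E.
Proof.
rewrite /unblocked (@no_gadget _ _ _ _ lambda X D XD (cell e x y) c h).
- rewrite area_cell// /=; congr (_ * _)%:E.
  under eq_bigr => l _ do rewrite gadget_weight_cell.
  by rewrite big_const_seq count_predT size_iota iter_mulr_1.
- by move=> o; exact: (measurable_block_family o (measurable_cell e x y)).
- by move=> o; apply: (@area_block_family (cell e x y) o); rewrite area_cell ?ltry.
- exact: trivIset_block_family.
Qed.

(* Dominates the number of points in the cell on the event [unblocked m]; the
   factor [2 ^+ n >= n] makes the Poisson series an exponential one. *)
Definition unblocked_count m (w : T) : \bar R :=
  \sum_(0 <= n <oo) ((2 ^+ n)%:E * (\1_(ncount X (cell e x y) n `&` unblocked m) w)%:E).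

Let term0 m n w :
  0 <= ((2 ^+ n)%:E * (\1_(ncount X (cell e x y) n `&` unblocked m) w)%:E) :> \bar R.
Proof. by rewrite -EFinM lee_fin mulr_ge0// exprn_ge0. Qed.

Let mterm m n : measurable_fun setT (fun w =>
  (2 ^+ n)%:E * (\1_(ncount X (cell e x y) n `&` unblocked m) w)%:E : \bar R).
Proof.
apply: measurable_funeM; apply/measurable_EFinP; apply: measurable_indic.
apply: measurableI; last exact: measurable_unblocked.
by apply: (measurable_ncount XD); exact: measurable_cell.
Qed.

Lemma unblocked_count_ge0 m w : 0 <= unblocked_count m w.
Proof. by apply: nneseries_ge0 => n _ _; exact: term0. Qed.

Lemma measurable_unblocked_count m : measurable_fun setT (unblocked_count m).
Proof. exact: ge0_emeasurable_sum. Qed.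

Lemma le_unblocked_count m w n : unblocked m w -> ncount X (cell e x y) n w ->
  n%:R%:E <= unblocked_count m w.
Proof.
move=> uw nw; apply: le_trans (_ : (2 ^+ n)%:E <= _).
  by rewrite lee_fin -natrX ler_nat ltnW// ltn_expl.
rewrite /unblocked_count (@nneseriesD1 _ _ n)//.
rewrite indicE mem_set// mule1 leeDl//; apply: nneseries_ge0 => k _ _; exact: term0.
Qed.

(** The count in the cell is independent of the gadgets ahead. The generating function at 2
    contributes [expR s] with [s = lambda * e ^+ 2] at most 4, and each block contributes a factor
    at most [1 - rho]. *)
Lemma integral_unblocked_count m :
  \int[P]_w unblocked_count m w <= (expR 4 * (1 - rho) ^+ m)%:E.
Proof.
rewrite integral_nneseries//.
have E n : \int[P]_w ((2 ^+ n)%:E * (\1_(ncount X (cell e x y) n `&` unblocked m) w)%:E) =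
    ((1 - gw) ^+ m)%:E * (2 ^+ n * poisson_weight (lambda * e ^+ 2) n)%:E.
  have mZ : measurable (ncount X (cell e x y) n `&` unblocked m).
    apply: measurableI; last exact: measurable_unblocked.
    by apply: (measurable_ncount XD); exact: measurable_cell.
  rewrite ge0_integralZl//; last by apply/measurable_EFinP; exact: measurable_indic.
  rewrite integral_indic// setIT.
  transitivity ((2 ^+ n)%:E *
    (poisson_weight (lambda * e ^+ 2) n * (1 - gw) ^+ m)%:E).
    by rewrite -unblocked_prob.
  by rewrite -!EFinM; congr (_%:E); ring.
under eq_eseriesr do rewrite E.
have s0 : (0 <= lambda * e ^+ 2)%R by apply: le_trans lower_e.
rewrite nneseriesZl; last first.
  move=> n _; rewrite lee_fin mulr_ge0 ?exprn_ge0// divr_ge0// mulr_ge0 ?expR_ge0//.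
  exact: exprn_ge0.
rewrite poisson_weight_series// -EFinM lee_fin mulrC.
apply: ler_pM; rewrite ?expR_ge0 ?exprn_ge0//.
- by rewrite subr_ge0 gw_le1.
- by rewrite ler_expR; move: upper_e; set s := (lambda * _)%R => s4; lra.
- by apply: lerXn2r; rewrite ?nnegrE ?subr_ge0 ?gw_le1 ?lerD2l ?lerN2 ?rho_le_gw//
    (le_trans rho_le_gw gw_le1).
Qed.

End Family.
End Scale.
End Estimates.

(** * Bounds on the number of escaping rays *)

Section EscapingRays.
Context {R : realType} d (T : measurableType d) (P : probability T R).
Context (lambda : R) (X : nat -> T -> R * R) (D : nat -> T -> bool).
Hypothesis XD : marked_poisson_process P lambda X D.
Variables (N e : R) (K : nat).
Hypotheses (e_gt0 : 0 < e) (NK : N = K%:R * e).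

Definition along (dir : bool) (i j : nat) := if dir then i else j.

(* The number of blocks of the family that fit between the cell [(i, j)] and
   the side of the square faced by the rays of direction [dir] and sign [b]. *)
Definition nb_blocks (dir b : bool) (i j : nat) : nat :=
  ((if b then along dir i j else K.-1 - along dir i j) %/ 3)%N.

(** Only the center has to lie in the square, since its point must emit rays. The block itself may
    overhang sideways, as gadgets are events of the process on the whole plane. *)
Lemma block_center_in_square (dir b : bool) (i j : 'I_K) l z :
  (l < nb_blocks dir b i j)%N ->
  cell e (cx e (i%:R * e) dir b l) (cy e (j%:R * e) dir b l) z -> square N z.
Proof.
rewrite /nb_blocks leq_divRL// => lm /cellE zc; apply/squareE.
have natM (m n : nat) : (m <= n)%N -> m%:R * e <= n%:R * e.
  by move=> mn; rewrite ler_pM2r// ler_nat.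
have i0 : 0 <= i%:R * e by rewrite mulr_ge0// ltW.
have j0 : 0 <= j%:R * e by rewrite mulr_ge0// ltW.
have l0 : 0 <= l%:R * e by rewrite mulr_ge0// ltW.
have := natM _ _ (ltn_ord i); have := natM _ _ (ltn_ord j).
rewrite -!natr1 !mulrDl -NK => iK jK.
have lK : if b then 3 * (l%:R * e) + 3 * e <= (along dir i j)%:R * e
    else (along dir i j)%:R * e + 3 * (l%:R * e) + 4 * e <= N.
  case: (b) lm => lm.
    by have := natM _ _ lm; rewrite natrM -natr1; lra.
  (* Seen from the lower edge of the starting cell, block [l] ends after [3 l + 4] cell sides. *)
  have : (along dir i j + l * 3 + 4 <= K)%N.
    by move: lm; have := ltn_ord i; have := ltn_ord j; rewrite /along; case: (dir); lia.
  by move=> /natM; rewrite -NK !natrD natrM; lra.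
move: zc lK; rewrite /cx /cy /block_offset /along.
by case: (dir); case: (b); rewrite ?expr0 ?expr1; lra.
Qed.

Lemma nat_cell (a : R) : 0 <= a < N ->
  exists i : 'I_K, i%:R * e <= a < i%:R * e + e.
Proof.
move=> /andP[a0 aN]; have /truncn_itv/andP[h1 h2] : 0 <= a / e by rewrite divr_ge0// ltW.
have iK : (Num.truncn (a / e) < K)%N.
  rewrite -(ltr_nat R); apply: le_lt_trans h1 _.
  by rewrite ltr_pdivrMr// -NK.
exists (Ordinal iK) => /=; rewrite -ler_pdivlMr// h1 /=.
by move: h2; rewrite ltr_pdivrMr// -natr1 mulrDl mul1r.
Qed.

Local Open Scope ereal_scope.

(** The almost sure properties that make the geometry deterministic: finitely many rays, so that
    stopping times exist, no repeated point, and all bases strictly inside the square. *)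
Definition regular (w : T) : Prop :=
  [/\ injective (X ^~ w), finite_set [set k | square N (X k w)] &
      forall k, square N (X k w) ->
        (0 < (X k w).1 < N)%R /\ (0 < (X k w).2 < N)%R].

Lemma finite_marked_points w : regular w ->
  finite_set (marked_points_in (square N) X D w).
Proof. by move=> [_ fin _]; exact: finite_image. Qed.

(** Escaping rays are sorted by direction, sign and cell of origin. A class with a gadget ahead is
    empty; any other class injects into the points of its cell. *)
Lemma nb_escaping_rays_le w : regular w -> nb_escaping_rays N X D w <=
  \sum_(q : (bool * bool) * ('I_K * 'I_K))
    unblocked_count X D e (q.2.1%:R * e) (q.2.2%:R * e) q.1.1 q.1.2
      (nb_blocks q.1.1 q.1.2 q.2.1 q.2.2) w.
Proof.
move=> reg; have [inj fin int] := reg; have fm := finite_marked_points reg.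
pose Er (q : (bool * bool) * ('I_K * 'I_K)) : set (((R * R) * bool) * bool) :=
  [set r | [/\ escaping_rays N (marked_points_in (square N) X D w) r,
    r.1.2 = q.1.1, r.2 = q.1.2 & cell e (q.2.1%:R * e) (q.2.2%:R * e) r.1.1]].
apply: (@le_trans _ _ (counting [set r | exists2 q, q \in index_enum _ & Er q r])).
  apply: counting_le => -[[u dir] b] esc.
  have [[k sk [uk _]] _] := esc.
  have [h1 h2] := int _ sk; rewrite uk /= in h1 h2.
  have [|i hi] := @nat_cell u.1; first by case/andP: h1 => /ltW -> ->.
  have [|j hj] := @nat_cell u.2; first by case/andP: h2 => /ltW -> ->.
  exists ((dir, b), (i, j)); first exact: mem_index_enum.
  by split=> //; apply/cellE.
apply: (le_trans (counting_bigcup_seq_le _ _)).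
apply: lee_sum => -[[dir b] [i j]] _ /=.
have [ub|/existsNP[l /not_implyP[lm /contrapT gad]]] := pselect
    (unblocked X D e (i%:R * e) (j%:R * e) dir b (nb_blocks dir b i j) w).
  pose I := [set k | cell e (i%:R * e) (j%:R * e) (X k w)].
  have fI : finite_set I.
    apply: sub_finite_set fin => k /cellE/= [h1 h2]; apply/squareE.
    have i0 : (0 <= i%:R * e)%R by rewrite mulr_ge0// ltW.
    have j0 : (0 <= j%:R * e)%R by rewrite mulr_ge0// ltW.
    have : (i.+1%:R * e <= N)%R by rewrite NK ler_pM2r// ler_nat.
    have : (j.+1%:R * e <= N)%R by rewrite NK ler_pM2r// ler_nat.
    by rewrite -!natr1 !mulrDl; lra.
  have [n nI] := @finite_countingP R _ _ fI.
  apply: le_trans (le_unblocked_count ub nI).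
  rewrite -nI -(@counting_image _ _ _ (fun k => (X k w, dir, b)) I); last first.
    by move=> k k' _ _ [/inj].
  apply: counting_le => -[[u dir'] b'] [esc /= -> ->].
  by have [[k sk [<- _]] _] := esc => ck; exists k.
(* From here on, some block [l] ahead of the cell is a gadget with orthogonal mark, and it stops
   every ray of the class. *)
rewrite (_ : Er _ = [set` [::]]) ?counting_seq//; first exact: unblocked_count_ge0.
apply/seteqP; split=> // -[[u dir'] b'] [esc /= ? ? ucell]; subst dir' b'.
have [[k sk [uk Dk]] _] := esc; subst u.
move: lm; rewrite mem_iota add0n => /andP[_ lm].
have [k' [ck' Dk' uniq_k']] := gadget_unique e_gt0 gad.
have sk' := block_center_in_square lm ck'.
have [u1 u2] := int _ sk; have [v1 v2] := int _ sk'.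
exfalso; apply: (blocked_not_escaping fm _ _ u1 u2 v1 v2 ck' _ _ _ esc).
- by exists k => //; rewrite Dk.
- by exists k' => //; rewrite Dk'.
- by move=> m [k'' _ <-] /= /uniq_k' ->.
- by move: ucell => /cellE/=; rewrite /cx /cy; case: (dir) => -[].
move: ucell ck' => /cellE/= ucell /cellE/= vcell.
have l0 : (0 <= l%:R * e)%R by rewrite mulr_ge0// ltW.
move: ucell vcell; rewrite /cx /cy /block_offset.
by case: (dir); case: (b); rewrite ?expr0 ?expr1; lra.
Qed.

(* Block 0 is shifted by two cells from the origin of its family, hence the
   origin [K - 3] for a center in the last column. *)
Definition border_gadget (j : nat) : set T :=
  gadget X D (cell e (cx e ((K%:R - 3) * e) true false 0) (cy e (j%:R * e) true false 0))
    (halo e (cx e ((K%:R - 3) * e) true false 0) (cy e (j%:R * e) true false 0)) true.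

Lemma border_gadget_escaping w (j : 'I_K) : regular w -> border_gadget j w ->
  exists r : ((R * R) * bool) * bool,
    escaping_rays N (marked_points_in (square N) X D w) r /\
    (j%:R * e <= r.1.1.2 < j%:R * e + e)%R.
Proof.
move=> reg gad; have fm := finite_marked_points reg.
have [k [ck Dk uniq_k]] := gadget_unique e_gt0 gad.
have j0 : (0 <= j%:R * e)%R by rewrite mulr_ge0// ltW.
have jN : (j%:R * e + e <= N)%R.
  have : (j.+1%:R * e <= N)%R by rewrite NK ler_pM2r// ler_nat.
  by rewrite -natr1 mulrDl mul1r.
have cxN : (cx e ((K%:R - 3) * e) true false 0 + e = N)%R.
  by rewrite NK /cx /block_offset expr0; ring.
have sk : square N (X k w).
  by move: ck => /cellE; move: cxN; rewrite /cy => cxN ?; apply/squareE; split; lra.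
exists (X k w, true, false); split; last by have /cellE[] := ck.
apply: (isolated_escaping fm _ ck _ _ cxN) => //.
- by exists k => //; rewrite Dk.
- by move=> m [k' _ <-] /= /uniq_k ->.
- by rewrite e_gt0 /=; lra.
Qed.

(** The rays given by border gadgets of different rows start in disjoint horizontal strips, hence
    are distinct. *)
Lemma nb_escaping_rays_ge w : regular w ->
  \sum_(j < K) (\1_(border_gadget j) w)%:E <= nb_escaping_rays N X D w.
Proof.
move=> reg; pose s := [seq j : 'I_K <- index_enum 'I_K | `[< border_gadget j w >]].
have [f fP] : {f : 'I_K -> ((R * R) * bool) * bool & forall j : 'I_K, border_gadget j w ->
    escaping_rays N (marked_points_in (square N) X D w) (f j) /\
    (j%:R * e <= (f j).1.1.2 < j%:R * e + e)%R}.
  apply: (@choice _ _ (fun (j : 'I_K) r => border_gadget j w ->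
    escaping_rays N (marked_points_in (square N) X D w) r /\
    (j%:R * e <= r.1.1.2 < j%:R * e + e)%R)) => j.
  (* The ray chosen for a row without gadget is arbitrary; [s] filters such rows out. *)
  have [gj|gj] := pselect (border_gadget j w); last by exists ((0, 0), true, true)%R.
  by have [r hr] := border_gadget_escaping reg gj; exists r.
have sP (j : 'I_K) : j \in s -> border_gadget j w by rewrite mem_filter => /andP[/asboolP].
have us : uniq (map f s).
  rewrite map_inj_in_uniq ?filter_uniq ?index_enum_uniq// => i j /sP gi /sP gj fij.
  have [_ hi] := fP _ gi; have [_ hj] := fP _ gj; rewrite -fij in hj; clear fij.
  have lt_contra (a b : 'I_K) : (a < b)%N -> (a%:R * e + e <= b%:R * e)%R.
    by move=> ab; rewrite -{2}[e]mul1r -mulrDl natr1 ler_pM2r// ler_nat.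
  move/andP: hi => [i1 i2]; move/andP: hj => [j1 j2].
  apply/val_inj; have [/lt_contra h|/lt_contra h|//] := ltngtP i j; exfalso.
    by have := le_lt_trans (le_trans h j1) i2; rewrite ltxx.
  by have := le_lt_trans (le_trans h i1) j2; rewrite ltxx.
have -> : \sum_(j < K) (\1_(border_gadget j) w)%:E = (size s)%:R%:E :> \bar R.
  rewrite /s; elim: (index_enum _) => [|j t IHt]; first by rewrite big_nil.
  rewrite big_cons IHt /= indicE; have [gj|gj] := pselect (border_gadget j w).
    by rewrite mem_set// asboolT//= -EFinD nat1r.
  by rewrite memNset// asboolF//= add0e.
rewrite -(size_map f) -(counting_seq us); apply: counting_le => _ /= /mapP[j /sP gj ->].
by have [] := fP _ gj.
Qed.

End EscapingRays.

(** * Geometric sums and choice of the mesh *)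

Section Sums.
Context {R : realType}.

(** Each power of [r] occurs at most three times, whence three geometric series. The factor [1 - r]
    on the left avoids a division and allows [r = 1]. *)
Lemma sum_exp_div3 (r : R) (K : nat) : 0 <= r <= 1 ->
  (1 - r) * (\sum_(i < K) r ^+ (i %/ 3)) <= 3.
Proof.
move=> r01; elim: K {-2}K (leqnn K) => [|m IHm] K.
  by rewrite leqn0 => /eqP ->; rewrite big_ord0 mulr0.
have [k3 _|] := leqP K 3.
  apply: (@le_trans _ _ (\sum_(i < K) 1)).
    rewrite mulr_sumr; apply: ler_sum => i _.
    by rewrite mulr_ile1 ?exprn_ge0 ?exprn_ile1//; lra.
  by rewrite sumr_const card_ord ler_nat.
(* Removing the first three terms leaves [r] times a shorter sum of the same form, so the bound
   follows from [3 * (1 - r) + r * 3 = 3]. *)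
case: K => [|[|[|k]]]// _; rewrite !ltnS => km.
rewrite 3!big_ord_recl /= !expr0.
have -> : \sum_(i < k) r ^+ (bump 0 (bump 0 (bump 0 i)) %/ 3) =
    r * \sum_(i < k) r ^+ (i %/ 3).
  rewrite mulr_sumr; apply: eq_bigr => i _; rewrite -exprS; congr (_ ^+ _).
  by rewrite /bump /=; lia.
have : (1 - r) * (\sum_(i < k) r ^+ (i %/ 3)) <= 3 by apply: IHm; lia.
set S := \sum_(_ < _) _ => hS; nra.
Qed.

(** The exponent depends only on the coordinate along the ray. That coordinate contributes 3, the
    transversal one [K], and there are four pairs of direction and sign. *)
Lemma sum_nb_blocks (r : R) (K : nat) : 0 <= r <= 1 ->
  (1 - r) * (\sum_(q : (bool * bool) * ('I_K * 'I_K))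
     r ^+ nb_blocks K q.1.1 q.1.2 q.2.1 q.2.2) <= 12 * K%:R.
Proof.
move=> r01.
rewrite -(pair_bigA _ (fun (p : bool * bool) (o : 'I_K * 'I_K) =>
  r ^+ nb_blocks K p.1 p.2 o.1 o.2)) /= mulr_sumr.
have -> : 12 * K%:R = \sum_(p : bool * bool) 3 * K%:R :> R.
  by rewrite sumr_const card_prod card_bool -mulr_natl; ring.
apply: ler_sum => -[dir b] _ /=.
rewrite -(pair_bigA _ (fun i j : 'I_K => r ^+ nb_blocks K dir b i j)) /=.
pose m i := if b then (i %/ 3)%N else ((K.-1 - i) %/ 3)%N.
have mS : (1 - r) * (\sum_(i < K) r ^+ m i) <= 3.
  rewrite /m; case: (b); first exact: sum_exp_div3.
  rewrite (reindex_inj rev_ord_inj) /= (eq_bigr (fun i : 'I_K => r ^+ (i %/ 3))).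
    exact: sum_exp_div3.
  by move=> i _; congr (r ^+ (_ %/ _)); have := ltn_ord i; lia.
have -> : \sum_(i < K) \sum_(j < K) r ^+ nb_blocks K dir b i j =
    (\sum_(i < K) r ^+ m i) * K%:R.
  have nbE i j : nb_blocks K dir b i j = m (along dir i j).
    by rewrite /nb_blocks /m; case: (b).
  rewrite /along in nbE; case: (dir) nbE => nbE.
    rewrite mulr_suml; apply: eq_bigr => i _.
    under eq_bigr => j _ do rewrite nbE.
    by rewrite sumr_const card_ord mulr_natr.
  transitivity (\sum_(i < K) \sum_(j < K) r ^+ m j).
    by apply: eq_bigr => i _; apply: eq_bigr => j _; rewrite nbE.
  by rewrite sumr_const card_ord mulr_natr.
by rewrite mulrA ler_wpM2r.
Qed.

(** With [K] the integer part of [Num.sqrt lambda * N] and [e = N / K], the quotient of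
    [Num.sqrt lambda * N] by [K] lies between 1 and 2; its square is [lambda * e ^+ 2]. *)
Lemma square_mesh (lambda N : R) : 0 < lambda -> (Num.sqrt lambda)^-1 <= N ->
  exists (K : nat) (e : R), [/\ (0 < K)%N, 0 < e, N = K%:R * e &
    [/\ 1 <= lambda * e ^+ 2, lambda * e ^+ 2 <= 4,
        K%:R <= Num.sqrt lambda * N & Num.sqrt lambda * N <= 2 * K%:R]].
Proof.
move=> l0 N0; have s0 : 0 < Num.sqrt lambda by rewrite sqrtr_gt0.
have sN : 1 <= Num.sqrt lambda * N by rewrite -ler_pdivrMl// mulr1.
have Np : 0 < N by apply: lt_le_trans N0; rewrite invr_gt0.
pose K := Num.truncn (Num.sqrt lambda * N).
have K0 : (0 < K)%N by rewrite truncn_gt0.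
have KR : 1 <= K%:R :> R by rewrite ler1n.
have /truncn_itv/andP[K1 K2] : 0 <= Num.sqrt lambda * N by lra.
rewrite -natr1 -/K in K1 K2.
have KR0 : 0 < K%:R :> R by lra.
exists K, (N / K%:R); split=> //; first by rewrite divr_gt0.
  by rewrite mulrC divfK// gt_eqF.
have -> : lambda * (N / K%:R) ^+ 2 = (Num.sqrt lambda * N / K%:R) ^+ 2.
  by rewrite -{1}(sqr_sqrtr (ltW l0)) -exprMn mulrA.
have q1 : 1 <= Num.sqrt lambda * N / K%:R by rewrite ler_pdivlMr// mul1r.
have q2 : Num.sqrt lambda * N / K%:R <= 2 by rewrite ler_pdivrMr//; lra.
split=> //; last lra.
  by rewrite exprn_ege1.
have -> : 4 = 2 ^+ 2 :> R by ring.
by apply: lerXn2r => //; rewrite nnegrE; lra.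
Qed.

End Sums.

Unset Implicit Arguments.
Set Strict Implicit.

Theorem theorem2p3 (R : realType) :
  exists C1 C2 : R, [/\ 0 < C1, 0 < C2 &
    forall lambda : R, 0 < lambda ->
    exists N0 : R, forall N : R, N0 <= N ->
    forall (d : measure_display) (T : measurableType d) (P : probability T R)
           (X : nat -> T -> R * R) (D : nat -> T -> bool),
      marked_poisson_process P lambda X D ->
      ((C1 * Num.sqrt lambda * N)%:E <= \int[P]_w nb_escaping_rays N X D w
       /\ \int[P]_w nb_escaping_rays N X D w < (C2 * Num.sqrt lambda * N)%:E)%E].
Proof.
pose r : R := @rho R.
have r0 : 0 < r by rewrite /r /rho mulr_gt0// expR_gt0.
have r1 : r <= 1.
  have : expR (- 36) <= 1 :> R by rewrite -expR0 ler_expR oppr_le0.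
  by rewrite /r /rho; lra.
have E0 : 0 < expR 4 :> R by exact: expR_gt0.
(* The lower bound obtained is [r * K], with [K] at least half of [Num.sqrt lambda * N]. The upper
   one is [12 * K * expR 4 / r], with [K] at most [Num.sqrt lambda * N]; 13 in place of 12 makes it
   strict. *)
exists (r / 2), (13 * expR 4 / r); split; first by rewrite divr_gt0.
  by rewrite divr_gt0// mulr_gt0.
(* This threshold guarantees at least one cell per side. *)
move=> lambda l0; exists (Num.sqrt lambda)^-1 => N N0 d T P X D XD.
have [K [e [K0 e0 NK [se1 se4 KN NK2]]]] := square_mesh l0 N0.
have Np : 0 < N by rewrite NK mulr_gt0// ltr0n.
have [Z [mZ PZ regZ]] := almost_surely_regular XD l0 Np.
have nb0 w : (0 <= nb_escaping_rays N X D w)%E by exact: counting_ge0.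
have K1 : 1 <= K%:R :> R by rewrite ler1n.
split.
  have mG j : measurable (border_gadget X D e K j).
    by apply: (measurable_gadget XD); [exact: measurable_cell|exact: measurable_halo].
  (* Removing [Z] from the gadgets makes the lower bound hold at every point, as the comparison with
     a possibly nonmeasurable function requires; the probabilities do not change. *)
  pose G j := border_gadget X D e K j `\` Z.
  have mGZ j : measurable (G j) by exact: measurableD.
  apply: (@le_trans _ _ (\int[P]_w \sum_(j < K) (\1_(G j) w)%:E)%E); last first.
    apply: le_integral_nonmeasurable => w; first by apply: sume_ge0 => j _; rewrite lee_fin.
    have [Zw|nZw] := pselect (Z w).
      rewrite big1 ?nb0// => j _; rewrite indicE memNset// => -[]//.
    apply: le_trans (nb_escaping_rays_ge D e0 NK (regZ w nZw)).
    apply: lee_sum => j _; rewrite lee_fin !indicE ler_nat.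
    have [[Gj nZ]|nGj] := pselect (G j w); last by rewrite (memNset nGj).
    by rewrite (mem_set Gj) leq_b1.
  rewrite ge0_integral_sum//; last first.
    by move=> j; apply/measurable_EFinP; exact: measurable_indic.
  have -> : (\sum_(j < K) \int[P]_w (\1_(G j) w)%:E =
      \sum_(j < K) P (border_gadget X D e K j))%E.
    apply: eq_bigr => j _; rewrite integral_indic// setIT.
    apply: (measure_eq_off_null _ _ mZ PZ) => // w nZw.
    by split=> [[]|].
  under eq_bigr => j _ do rewrite (gadget_prob XD e0).
  rewrite sumEFin lee_fin sumr_const card_ord -[leRHS]mulr_natr.
  have := @rho_le_gw R lambda e se1 se4; rewrite -/r => rg.
  apply: (@le_trans _ _ (r * K%:R)); last by rewrite ler_wpM2r.
  rewrite -mulrA -mulrA ler_pM2l//; lra.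
pose uc (q : (bool * bool) * ('I_K * 'I_K)) :=
  unblocked_count X D e (q.2.1%:R * e) (q.2.2%:R * e) q.1.1 q.1.2
    (nb_blocks K q.1.1 q.1.2 q.2.1 q.2.2).
have muc q : measurable_fun setT (uc q) by exact: (measurable_unblocked_count XD).
have uc0 q w : (0 <= uc q w)%E by exact: unblocked_count_ge0.
(* Here the larger function is measurable, so the inequality is needed only outside [Z]. *)
apply: (@le_lt_trans _ _ (\int[P]_w \sum_q uc q w)%E).
  apply: (le_integral_off_null _ _ _ mZ PZ) => //.
  - by move=> w; apply: sume_ge0 => q _.
  - exact: emeasurable_sum.
  - by move=> w /regZ; exact: nb_escaping_rays_le.
rewrite ge0_integral_sum//.
apply: (@le_lt_trans _ _
  (\sum_(q : (bool * bool) * ('I_K * 'I_K))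
    (expR 4 * (1 - r) ^+ nb_blocks K q.1.1 q.1.2 q.2.1 q.2.2)%:E)%E).
  by apply: lee_sum => q _; exact: (integral_unblocked_count XD e0 se1 se4).
rewrite sumEFin lte_fin -mulr_sumr.
have r01 : 0 <= 1 - r <= 1 by lra.
have := sum_nb_blocks K r01; set S := \sum_(q : _) _; rewrite subKr => rS.
have rS' : S <= 12 * K%:R / r by rewrite ler_pdivlMr// mulrC.
apply: (@le_lt_trans _ _ (expR 4 * (12 * K%:R / r))); first by rewrite ler_pM2l.
have -> : expR 4 * (12 * K%:R / r) = (12 * K%:R) * (expR 4 / r) by ring.
have -> : 13 * expR 4 / r * Num.sqrt lambda * N =
  (13 * (Num.sqrt lambda * N)) * (expR 4 / r) by ring.
rewrite ltr_pM2r ?divr_gt0//; lra.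
Qed.
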